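(* Let $n,m\ge 2$ be integers with $n\le m$ and $d=m+n$. Then there exists a real $n\times m$ matrix $\Theta$ which is completely irrational and good and satisfies $R(\Theta)=n+2$.
   Context: Write vectors of $\mathbb{R}^d$ as $\pmb{z}=(\pmb{x},\pmb{y})^\top$ with $\pmb{x}\in\mathbb{R}^m$, $\pmb{y}\in\mathbb{R}^n$. For $\pmb{\xi}\in\mathbb{R}^k$ let $|\pmb{\xi}|=\max_j|\xi_j|$ (sup-norm) and $\|\pmb{\xi}\|=\min_{\pmb{a}\in\mathbb{Z}^k}|\pmb{\xi}-\pmb{a}|$. A linear subspace $\mathcal{R}\subset\mathbb{R}^d$ of dimension $r$ is rational if $\mathcal{R}\cap\mathbb{Z}^d$ is a lattice of rank $r$. The matrix $\Theta$ (equivalently the $m$-dimensional subspace $\mathcal{L}_\Theta=\{\pmb{z}:\pmb{y}=\Theta\pmb{x}\}$) is completely irrational if $\mathcal{L}_\Theta\cap\mathcal{R}=\{\pmb{0}\}$ for every rational subspace $\mathcal{R}$ of dimension $n$. A nonzero integer vector $\pmb{x}\in\mathbb{Z}^m$ is a best approximation for $\Theta$ if $\|\Theta\pmb{x}\|<\|\Theta\pmb{x}'\|$ for all nonzero integer $\pmb{x}'$ with $|\pmb{x}'|\le|\pmb{x}|$, $\pmb{x}'\ne\pm\pmb{x}$; its extended vector is $\pmb{z}=(\pmb{x},\pmb{y})^\top$ where $\pmb{y}\in\mathbb{Z}^n$ satisfies $|\Theta\pmb{x}-\pmb{y}|=\|\Theta\pmb{x}\|$. $\Theta$ is called good if the sequence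 of extended best approximation vectors $\pm\pmb{z}_\nu=\pm(\pmb{x}_\nu,\pmb{y}_\nu)^\top$, $\nu=1,2,\dots$, with $|\pmb{x}_1|<|\pmb{x}_2|<\cdots$ and $\|\Theta\pmb{x}_1\|>\|\Theta\pmb{x}_2\|>\cdots$, is uniquely determined (up to sign of each term). For good $\Theta$, $R(\Theta)$ is the least integer $s$ such that there exist a linear subspace $\mathcal{R}\subset\mathbb{R}^d$ of dimension $s$ and $\nu_0$ with $\pmb{z}_\nu\in\mathcal{R}$ for all $\nu\ge\nu_0$. *)

(* Defs.v *)
From mathcomp Require Import all_boot all_order all_algebra.
From mathcomp Require Import all_classical all_reals all_analysis.

Set Implicit Arguments.
Unset Strict Implicit.
Unset Printing Implicit Defensive.

Import Order.TTheory GRing.Theory Num.Theory.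
Import numFieldNormedType.Exports.

Local Open Scope classical_set_scope.
Local Open Scope ring_scope.

(* Vectors are columns and z = (x, y) is [col_mx x y : 'cV_(m + n)], so that
   x = usubmx z and y = dsubmx z. On matrices `|.| is the library's sup-norm. *)

Definition intv (R : realType) (k : nat) (a : 'cV[int]_k) : 'cV[R]_k :=
  map_mx intr a.

(* The infimum is attained, so it is the minimum over a. *)
Definition dist_int (R : realType) (k : nat) (xi : 'cV[R]_k) : R :=
  inf [set `|xi - intv R a| | a in [set: 'cV[int]_k]].

(* [inIntSpan b v]: v is an integer linear combination of the b_i. *)
Definition is_lattice_of_rank (R : realType) (d r : nat) (S : set 'cV[R]_d) :=
  exists2 b : r.-tuple 'cV[R]_d, free b & S = [set v | inIntSpan b v].

Definition rational_subspace (R : realType) (d : nat) (U : {vspace 'cV[R]_d}) :=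
  is_lattice_of_rank (\dim U) ([set` U] `&` range (@intv R d)).

Definition graph_subspace (R : realType) (m n : nat) (Theta : 'M[R]_(n, m)) :
    set 'cV[R]_(m + n) :=
  [set z | dsubmx z = Theta *m usubmx z].

Definition completely_irrational (R : realType) (m n : nat)
    (Theta : 'M[R]_(n, m)) :=
  forall U : {vspace 'cV[R]_(m + n)}, rational_subspace U -> \dim U = n ->
    graph_subspace Theta `&` [set` U] = [set 0].

Definition best_approx (R : realType) (m n : nat) (Theta : 'M[R]_(n, m))
    (x : 'cV[int]_m) :=
  x != 0 /\
  forall x' : 'cV[int]_m, x' != 0 -> `|intv R x'| <= `|intv R x| ->
    x' != x -> x' != - x ->
    dist_int (Theta *m intv R x) < dist_int (Theta *m intv R x').

Definition extended_best_approx (R : realType) (m n : nat)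
    (Theta : 'M[R]_(n, m)) (z : 'cV[int]_(m + n)) :=
  best_approx Theta (usubmx z) /\
  `|Theta *m intv R (usubmx z) - intv R (dsubmx z)|
    = dist_int (Theta *m intv R (usubmx z)).

(* The last clause says that no best approximation is left out: without it
   every subsequence would qualify as well. *)
Definition best_approx_seq (R : realType) (m n : nat) (Theta : 'M[R]_(n, m))
    (z : nat -> 'cV[int]_(m + n)) :=
  [/\ forall nu, extended_best_approx Theta (z nu),
      forall nu, `|intv R (usubmx (z nu))| < `|intv R (usubmx (z nu.+1))|,
      forall nu, dist_int (Theta *m intv R (usubmx (z nu.+1)))
                 < dist_int (Theta *m intv R (usubmx (z nu)))
    & forall x, best_approx Theta x ->
        exists nu, x = usubmx (z nu) \/ x = - usubmx (z nu)].

Definition good (R : realType) (m n : nat) (Theta : 'M[R]_(n, m)) :=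
  exists z, best_approx_seq Theta z /\
    forall z', best_approx_seq Theta z' ->
      forall nu, z' nu = z nu \/ z' nu = - z nu.

Definition eventually_in_dim (R : realType) (d : nat) (z : nat -> 'cV[int]_d)
    (s : nat) :=
  exists U : {vspace 'cV[R]_d}, \dim U = s /\
    exists nu0, forall nu, (nu0 <= nu)%N -> intv R (z nu) \in U.

(* R(Theta) = s; meaningful for good Theta, where the sequence z exists and is
   unique up to signs, which do not affect membership in subspaces. *)
Definition best_approx_dim (R : realType) (m n : nat) (Theta : 'M[R]_(n, m))
    (s : nat) :=
  forall z, best_approx_seq Theta z ->
    eventually_in_dim R z s /\
    forall s', eventually_in_dim R z s' -> (s <= s')%N.

(* Main.v *)
(* Let q_0 < q_1 < ... grow
   very fast and suppose that q_k times the first column (k even), resp. the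
   second column (k odd), is extremely close to an integer vector. Then
   x = q_k e_1 or q_k e_2 beats every x outside the coordinate plane of e_1, e_2
   up to the height q_(k+1), so eventually all best approximations have
   x_3 = ... = x_m = 0: they lie in a rational subspace of dimension n + 2.
   Moreover dist(x_nu) |x_(nu+1)| tends to 0. If a tail of the z_nu were killed
   by a further rational functional, then the integers det(x_nu, x_(nu+1)) would
   be eventually 0, and z_nu, z_(nu+1) would be parallel, contradicting
   dist(x_(nu+1)) < dist(x_nu); thus n + 2 is optimal.

   Such a Theta is the limit of nested balls. At stage k column i_k of the
   centre is rational with denominator q_k; one makes the other column rational
   with a larger denominator q_(k+1) and perturbs the remaining columns so that
   no x outside the plane with |x| <= q_(k+1) is sent to an integer vector. The
   required inequalities then hold at the centre, where dist(q_k e_(i_k)) = 0,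
   hence on a small ball. Each stage also avoids the zero set of one polynomial
   from a countable list, which yields complete irrationality and goodness. *)

Require Import Defs.
From mathcomp Require Import all_boot all_order all_algebra.
From mathcomp Require Import all_classical all_reals all_analysis.
From mathcomp Require Import perm ring lra zify.

Set Implicit Arguments.
Unset Strict Implicit.
Unset Printing Implicit Defensive.

Import Order.TTheory GRing.Theory Num.Theory.
Import numFieldNormedType.Exports.

Local Open Scope classical_set_scope.
Local Open Scope ring_scope.

(** * Sup-norm and distance to the integers *)

Section DistInt.
Variables (R : realType).

Lemma ler_mxnorm m n (A : 'M[R]_(m, n)) i j : `|A i j| <= `|A|.
Proof.
by rewrite [leRHS]/Num.Def.normr/= mx_normrE; apply: (le_bigmax _ _ (i, j)).
Qed.

Lemma mxnorm_le m n (A : 'M[R]_(m, n)) c :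
  0 <= c -> (forall i j, `|A i j| <= c) -> `|A| <= c.
Proof.
move=> c0 Ac; rewrite [leLHS]/Num.Def.normr/= mx_normrE.
by apply: bigmax_le => // -[i j] _; exact: Ac.
Qed.

Lemma mxnorm_attained m n (A : 'M[R]_(m, n)) : A != 0 ->
  exists i j, `|A| = `|A i j|.
Proof.
move=> A0; have A0' : mx_norm A != 0.
  by apply: contra_neq A0; exact: mx_norm_eq0.
by have [[i j] h] := mx_norm_neq0 A0'; exists i, j.
Qed.

Lemma intvN k (a : 'cV[int]_k) : intv R (- a) = - intv R a.
Proof. by apply/matrixP => i j; rewrite !mxE rmorphN. Qed.

Lemma dist_int_le k (xi : 'cV[R]_k) a : dist_int xi <= `|xi - intv R a|.
Proof.
apply: ge_inf; last by exists a.
by exists 0 => _ [b _ <-].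
Qed.

Lemma dist_int_ge k (xi : 'cV[R]_k) c :
  (forall a, c <= `|xi - intv R a|) -> c <= dist_int xi.
Proof.
move=> h; apply: lb_le_inf; first by exists `|xi - intv R 0|, 0.
by move=> _ [b _ <-].
Qed.

Lemma dist_int_ge0 k (xi : 'cV[R]_k) : 0 <= dist_int xi.
Proof. by apply: dist_int_ge. Qed.

Lemma dist_int_lipschitz k (xi eta : 'cV[R]_k) :
  dist_int xi <= dist_int eta + `|xi - eta|.
Proof.
rewrite -lerBlDr; apply: dist_int_ge => a; rewrite lerBlDr.
apply: le_trans (dist_int_le xi a) _.
rewrite [leRHS]addrC; apply: le_trans (ler_normD _ _).
by rewrite addrA subrK.
Qed.

Definition nearest (t : R) : int := Num.floor (t + 2^-1).

Lemma nearestP t (z : int) : `|t - (nearest t)%:~R| <= `|t - z%:~R|.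
Proof.
have /andP[h1 h2] := real_floor_itv (num_real (t + 2^-1)).
rewrite -/(nearest t) in h1 h2 *; rewrite intrD in h2.
have [->//|] := eqVneq z (nearest t).
rewrite neq_lt ler_norml => /orP[zn|zn].
- have : (z%:~R + 1 <= (nearest t)%:~R :> R) by rewrite -intrD1 ler_int lezD1.
  have := ler_norm (t - z%:~R); lra.
- have : ((nearest t)%:~R + 1 <= z%:~R :> R) by rewrite -intrD1 ler_int lezD1.
  have := ler_norm (- (t - z%:~R)); rewrite normrN; lra.
Qed.

Lemma nearest_half t : `|t - (nearest t)%:~R| <= 2^-1.
Proof.
have /andP[h1 h2] := real_floor_itv (num_real (t + 2^-1)).
rewrite -/(nearest t) in h1 h2 *; rewrite intrD in h2.
by rewrite ler_norml; apply/andP; split; lra.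
Qed.

Definition nearestv k (xi : 'cV[R]_k) : 'cV[int]_k :=
  \col_i nearest (xi i 0).

(** In the sup-norm, rounding each coordinate separately minimises all of them at once, so the
    infimum in [dist_int] is attained. *)
Lemma nearestvP k (xi : 'cV[R]_k) :
  `|xi - intv R (nearestv xi)| = dist_int xi.
Proof.
apply: le_anti; rewrite dist_int_le andbT; apply: dist_int_ge => a.
apply: mxnorm_le => // i j.
apply: le_trans (ler_mxnorm (xi - intv R a) i j).
by rewrite !mxE !ord1; exact: nearestP.
Qed.

Lemma dist_int_half k (xi : 'cV[R]_k) : dist_int xi <= 2^-1.
Proof.
rewrite -nearestvP; apply: mxnorm_le; first by rewrite invr_ge0.
by move=> i j; rewrite !mxE ord1 nearest_half.
Qed.

Lemma dist_int_intv k (a : 'cV[int]_k) : dist_int (intv R a) = 0.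
Proof.
apply: le_anti; rewrite dist_int_ge0 andbT.
by apply: le_trans (dist_int_le _ a) _; rewrite subrr normr0.
Qed.

Lemma dist_int_gt0 k (xi : 'cV[R]_k) i :
  (forall z : int, xi i 0 != z%:~R) -> 0 < dist_int xi.
Proof.
move=> h; rewrite -nearestvP; apply: lt_le_trans (ler_mxnorm _ i 0).
by rewrite !mxE normr_gt0 subr_eq0.
Qed.

Lemma dist_intN k (xi : 'cV[R]_k) : dist_int (- xi) = dist_int xi.
Proof.
have le (eta : 'cV[R]_k) : dist_int (- eta) <= dist_int eta.
  apply: dist_int_ge => a; apply: le_trans (dist_int_le _ (- a)) _.
  by rewrite intvN opprK addrC -normrN opprD opprK addrC.
by apply: le_anti; rewrite le /= -{1}[xi]opprK le.
Qed.

(** The height of [x] as a natural number, so that least heights exist and heights can be located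
    between the [q k]. *)
Definition nrm k (x : 'cV[int]_k) : nat := \max_i absz (x i ord0).

Lemma nrm_ge k (x : 'cV[int]_k) i : (absz (x i ord0) <= nrm x)%N.
Proof. exact: leq_bigmax. Qed.

Lemma nrmE k (x : 'cV[int]_k) : `|intv R x| = (nrm x)%:R.
Proof.
have absE i : `|intv R x i 0| = (absz (x i ord0))%:R.
  by rewrite mxE -intr_norm -abszE.
apply: le_anti; apply/andP; split.
  by apply: mxnorm_le => // i j; rewrite ord1 absE ler_nat nrm_ge.
have [k0|k0] := posnP k; last first.
  have [|i Hi] := @bigop.eq_bigmax _ (fun i : 'I_k => absz (x i ord0)).
    by rewrite card_ord.
  rewrite /nrm Hi.
  by rewrite -absE ler_mxnorm.
rewrite /nrm big1 ?normr_ge0 // => i _; by have := ltn_ord i; rewrite {2}k0.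
Qed.

Lemma nrmN k (x : 'cV[int]_k) : nrm (- x) = nrm x.
Proof. by apply: eq_bigr => i _; rewrite mxE abszN. Qed.

Lemma nrm_eq0 k (x : 'cV[int]_k) : (nrm x == 0%N) = (x == 0).
Proof.
apply/eqP/eqP => [n0|->]; last by apply: big1 => i _; rewrite mxE.
apply/matrixP => i j; rewrite ord1 mxE; apply/eqP.
by rewrite -absz_eq0 -leqn0 (leq_trans (nrm_ge x i)) ?n0.
Qed.

End DistInt.

(** * Linear independence of the entries *)

Section IntegerBox.
Variable (m : nat).

(** The cube of radius [N] indexed by a finite type: minima over it exist, and finitely many
    neighbourhoods can be intersected over it. *)
Definition boxv N (v : {ffun 'I_m -> 'I_(N.*2.+1)}) : 'cV[int]_m :=
  \col_i ((v i)%:Z - N%:Z).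

Lemma boxv_surj N (x : 'cV[int]_m) : (nrm x <= N)%N ->
  exists v, x = @boxv N v.
Proof.
move=> xN; exists [ffun i => inord (absz (x i ord0 + N%:Z))].
apply/matrixP => i j; rewrite !mxE ffunE ord1.
have := leq_trans (nrm_ge x i) xN; move: (x i ord0) => t tN.
rewrite inordK; lia.
Qed.

Lemma exists_min (R : realType) (D : 'cV[int]_m -> R) (P : set 'cV[int]_m) N :
  (exists2 x, P x & (nrm x <= N)%N) ->
  exists x, [/\ P x, (nrm x <= N)%N &
    forall x', P x' -> (nrm x' <= N)%N -> D x <= D x'].
Proof.
move=> [x0 Px0 /[dup] x0N /boxv_surj[v0 x0E]].
pose Q v := `[< P (@boxv N v) /\ (nrm (@boxv N v) <= N)%N >].
have Qv0 : Q v0 by apply/asboolP; rewrite -x0E.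
case: (Order.TotalTheory.arg_minP (fun v => D (@boxv N v)) Qv0).
move=> v /asboolP[Pv vN] vmin; exists (boxv v); split => // x' Px' /[dup] x'N.
by move=> /boxv_surj[v' x'E]; rewrite x'E; apply: vmin; apply/asboolP; rewrite -x'E.
Qed.

End IntegerBox.

(** * Strictly increasing sequences of natural numbers *)

Lemma increasing_lt (f : nat -> nat) : (forall k, f k < f k.+1)%N ->
  forall i j, (i < j)%N -> (f i < f j)%N.
Proof. by move=> fS i j; exact: (homo_ltn ltn_trans fS). Qed.

Lemma increasing_ge (f : nat -> nat) : (forall k, f k < f k.+1)%N ->
  forall k, (k <= f k)%N.
Proof. by move=> fS; elim=> // k IH; exact: leq_ltn_trans IH (fS k). Qed.

Lemma increasing_locate (f : nat -> nat) N : (forall k, f k < f k.+1)%N ->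
  (f 0 <= N)%N -> exists k, (f k <= N < f k.+1)%N.
Proof.
move=> fS f0N; have [|k fk kmin] := @ex_minnP (fun k => N < f k)%N.
  by exists N.+1; exact: increasing_ge.
case: k fk kmin => [|k] fk kmin; first by rewrite ltnNge f0N in fk.
exists k; rewrite fk andbT leqNgt; apply/negP => /kmin.
by rewrite ltnn.
Qed.

(** Strong induction: if the sequences agree below [k], then [f k] is some [g j], and [j < k] would
    give [f k = f j]; hence [g k <= f k], and symmetrically. *)
Lemma increasing_same_range (a b : nat -> nat) :
  (forall k, a k < a k.+1)%N -> (forall k, b k < b k.+1)%N ->
  (forall i, exists j, a i = b j) -> (forall i, exists j, b i = a j) ->
  a =1 b.
Proof.
move=> /increasing_lt am /increasing_lt bm ab ba k; elim/ltn_ind: k => k IH.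
have le (f g : nat -> nat) : (forall i j, (i < j)%N -> (f i < f j)%N) ->
    (forall i j, (i < j)%N -> (g i < g j)%N) ->
    (forall i, exists j, f i = g j) ->
    (forall l, (l < k)%N -> f l = g l) -> (g k <= f k)%N.
  move=> fm gm fg fgk; have [j fkj] := fg k; rewrite fkj.
  have [jk|kj] := ltnP j k.
    by have := fm _ _ jk; rewrite fkj fgk ?ltnn.
  by move: kj; rewrite leq_eqVlt => /orP[/eqP->//|/gm/ltnW].
by apply/eqP; rewrite eqn_leq !le // => l /IH.
Qed.

(** * Rational linear forms in the entries of the matrix *)

Section LinearForms.
Variables (R : realType) (m n : nat).
Implicit Types (Theta : 'M[R]_(n, m)) (C : 'M[rat]_(n, m)).

Definition lin_form C (c : rat) Theta : R :=
  \sum_i \sum_j ratr (C i j) * Theta i j + ratr c.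

(** Linear independence over the rationals of 1 and all the entries of [Theta]. *)
Definition lin_free Theta := forall C c, C != 0 -> lin_form C c Theta != 0.

Definition row_coef (i : 'I_n) (x : 'cV[int]_m) : 'M[rat]_(n, m) :=
  \matrix_(i', j) ((i' == i)%:R * (x j 0)%:~R).

Lemma lin_formD C c C' c' Theta :
  lin_form (C + C') (c + c') Theta = lin_form C c Theta + lin_form C' c' Theta.
Proof.
rewrite /lin_form rmorphD/= addrACA -big_split/=; congr (_ + _).
apply: eq_bigr => i _; rewrite -big_split/=; apply: eq_bigr => j _.
by rewrite mxE rmorphD mulrDl.
Qed.

Lemma lin_formZ a C c Theta :
  lin_form (a *: C) (a * c) Theta = ratr a * lin_form C c Theta.
Proof.
rewrite /lin_form rmorphM/= mulrDr; congr (_ + _); rewrite mulr_sumr.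
apply: eq_bigr => i _; rewrite mulr_sumr; apply: eq_bigr => j _.
by rewrite mxE rmorphM mulrA.
Qed.

Lemma lin_form_row i x (c : int) Theta :
  lin_form (row_coef i x) c%:~R Theta = (Theta *m intv R x) i 0 + c%:~R.
Proof.
rewrite /lin_form ratr_int mxE; congr (_ + _).
rewrite (bigD1 i)//= [X in _ + X]big1 ?addr0; last first.
  move=> i' /negbTE i'i; apply: big1 => j _.
  by rewrite mxE i'i mul0r rmorph0 mul0r.
by apply: eq_bigr => j _; rewrite !mxE eqxx mul1r ratr_int mulrC.
Qed.

(** The case [k = 1] shows that no coordinate of [Theta x] is an integer, the case [k = 2] that none
    is a half-integer. *)
Lemma lin_free_row Theta i x (k c : int) : lin_free Theta -> x != 0 -> k != 0 ->
  k%:~R * (Theta *m intv R x) i 0 + c%:~R != 0.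
Proof.
move=> free x0 k0.
have -> : k%:~R * (Theta *m intv R x) i 0 + c%:~R =
  lin_form (row_coef i (k *: x)) c%:~R Theta.
  rewrite lin_form_row; congr (_ + _).
  rewrite !mxE mulr_sumr; apply: eq_bigr => j _.
  by rewrite !mxE rmorphM /= mulrCA.
apply: free; apply: contra_neq x0 => h; apply/matrixP => j l.
move/matrixP: h => /(_ i j); rewrite !mxE eqxx mul1r ord1 => /eqP.
by rewrite intr_eq0 mulf_eq0 (negbTE k0) => /eqP.
Qed.

Lemma dist_gt0 Theta x : (0 < n)%N -> lin_free Theta -> x != 0 ->
  0 < dist_int (Theta *m intv R x).
Proof.
move=> n0 free x0; apply: (@dist_int_gt0 _ _ _ (Ordinal n0)) => z.
have := @lin_free_row _ (Ordinal n0) x 1 (- z) free x0 isT.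
by rewrite mul1r rmorphN /= subr_eq0.
Qed.

(** The two distances are attained at coordinates [i] and [j], and their equality is a rational
    relation between entries of rows [i] and [j]. Independence makes its coefficients vanish: for
    [i = j] this reads [x = e *: x'] with a sign [e], for [i != j] it would force [x = 0]. *)
Lemma dist_inj Theta x x' : (0 < n)%N -> lin_free Theta -> x != 0 -> x' != 0 ->
  dist_int (Theta *m intv R x) = dist_int (Theta *m intv R x') ->
  x = x' \/ x = - x'.
Proof.
move=> n0 free x0 x'0.
have att w : w != 0 -> exists i (y : int),
    dist_int (Theta *m intv R w) = `|(Theta *m intv R w) i 0 - y%:~R|.
  move=> w0; set xi := Theta *m _.
  have xi0 : xi - intv R (nearestv xi) != 0.
    by rewrite -normr_eq0 nearestvP gt_eqF// dist_gt0.
  have [i [j E]] := mxnorm_attained xi0.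
  exists i, (nearestv xi i 0); rewrite -nearestvP E.
  by rewrite !mxE ord1.
have [i [y ->]] := att _ x0; have [j [y' ->]] := att _ x'0.
move=> /eqP; rewrite eqr_norm2 => h.
have [e [e1 E]] : exists e : int, (e = 1 \/ e = -1) /\
    (Theta *m intv R x) i 0 - y%:~R =
      e%:~R * ((Theta *m intv R x') j 0 - y'%:~R).
  case/orP: h => /eqP h; [exists 1|exists (-1)]; split; rewrite ?h; auto.
    by rewrite mul1r.
  by rewrite rmorphN mulN1r.
have C0 : row_coef i x + (- e%:~R) *: row_coef j x' = 0.
  apply/eqP; apply: contraT => /(free _ ((- y)%:~R + (- e%:~R) * (- y')%:~R)).
  rewrite lin_formD lin_formZ !lin_form_row !rmorphN /= ratr_int E.
  by rewrite mulNr subrr eqxx.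
have [ij|ij] := eqVneq i j.
  have -> : x = e *: x'.
    apply/matrixP => l l'; rewrite ord1 mxE; apply: (@intr_inj rat).
    move/matrixP: C0 => /(_ i l); rewrite !mxE ij eqxx !mul1r rmorphM/= => /eqP.
    by rewrite mulNr subr_eq0 => /eqP.
  case: e1 => ->; [left|right]; first by rewrite scale1r.
  by rewrite scaleN1r.
exfalso; move/eqP: x0; apply; apply/matrixP => l l'; rewrite ord1 mxE.
apply: (@intr_inj rat); move/matrixP: C0 => /(_ i l).
by rewrite !mxE eqxx (negbTE ij) mul0r mulr0 addr0 mul1r.
Qed.

(** Every coordinate error is at most the distance, hence at most 1/2, and independence excludes
    equality. Two integers at distance less than 1/2 from the same number coincide. *)
Lemma nearest_unique Theta x y y' : lin_free Theta -> x != 0 ->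
  `|Theta *m intv R x - intv R y| = dist_int (Theta *m intv R x) ->
  `|Theta *m intv R x - intv R y'| = dist_int (Theta *m intv R x) ->
  y = y'.
Proof.
move=> free x0 h h'; apply/matrixP => i j; rewrite ord1.
have half w : `|Theta *m intv R x - intv R w| = dist_int (Theta *m intv R x) ->
    `|(Theta *m intv R x) i 0 - (w i 0)%:~R| < 2^-1.
  move=> hw; rewrite lt_neqAle; apply/andP; split.
    apply/eqP => E.
    (* The two odd constants correspond to the errors 1/2 and -1/2. *)
    have := @lin_free_row _ i x 2 (- (2 * w i 0 + 1)) free x0 isT.
    have := @lin_free_row _ i x 2 (- (2 * w i 0 - 1)) free x0 isT.
    rewrite !rmorphN !rmorphD /= !rmorphN !rmorphM /= => /eqP h1 /eqP h2.
    case: (lerP 0 ((Theta *m intv R x) i 0 - (w i 0)%:~R)) => s.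
      by move: E; rewrite ger0_norm// => E; apply: h2; lra.
    by move: E; rewrite ltr0_norm// => E; apply: h1; lra.
  apply: le_trans (dist_int_half (Theta *m intv R x)); rewrite -hw.
  by have := ler_mxnorm (Theta *m intv R x - intv R w) i 0; rewrite !mxE.
have := half _ h; have := half _ h'; rewrite !ltr_norml.
move=> /andP[a1 a2] /andP[b1 b2].
have c1 : (y i 0)%:~R < (y' i 0 + 1)%:~R :> R by rewrite intrD; lra.
have c2 : (y' i 0)%:~R < (y i 0 + 1)%:~R :> R by rewrite intrD; lra.
rewrite !ltr_int in c1 c2; lia.
Qed.

End LinearForms.

(** * The sequence of best approximations *)

Section BestApproximations.
Variables (R : realType) (m n : nat) (Theta : 'M[R]_(n, m)).
Hypotheses (n0 : (0 < n)%N) (m0 : (0 < m)%N) (Tfree : lin_free Theta).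

Let D (x : 'cV[int]_m) := dist_int (Theta *m intv R x).

Let DN x : D (- x) = D x.
Proof. by rewrite /D intvN mulmxN dist_intN. Qed.

Let Dinj x x' : x != 0 -> x' != 0 -> D x = D x' -> x = x' \/ x = - x'.
Proof. exact: dist_inj. Qed.

Lemma best_approxE x : best_approx Theta x <-> x != 0 /\
  forall x', x' != 0 -> (nrm x' <= nrm x)%N -> x' != x -> x' != - x -> D x < D x'.
Proof.
split=> -[x0 h]; split=> // x' x'0 le; apply: h => //; move: le;
by rewrite !nrmE ler_nat.
Qed.

(** A minimiser of [D] over the nonzero vectors of a box is strict up to sign because [D] is
    injective up to sign. *)
Lemma best_of_norm N : (0 < N)%N -> exists x, [/\ best_approx Theta x,
  (nrm x <= N)%N & forall x', x' != 0 -> (nrm x' <= N)%N -> D x <= D x'].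
Proof.
move=> N0.
have [|x [x0 xN xmin]] := @exists_min m R D (fun x => x != 0) N.
  exists (const_mx 1).
    apply/eqP => /matrixP /(_ (Ordinal m0) 0); rewrite !mxE => /eqP.
    by rewrite oner_eq0.
  by apply/bigmax_leqP => i _; rewrite mxE.
exists x; split => //; apply/best_approxE; split => // x' x'0 le ne neN.
rewrite lt_neqAle xmin ?(leq_trans le)// andbT; apply/eqP => /esym.
by case/(Dinj x'0 x0) => [/eqP|/eqP]; apply/negP.
Qed.

Lemma best_approx_min x w : best_approx Theta x -> w != 0 ->
  (nrm w <= nrm x)%N -> D x <= D w.
Proof.
move=> /best_approxE[x0 xb] w0 wx.
have [->//|wnx] := eqVneq w x; have [->|wnNx] := eqVneq w (- x).
  by rewrite DN.
by apply: ltW; apply: xb.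
Qed.

(** Take the least height at which [D] drops below [D x], and minimise [D] up to that height. The
    last clause says that nothing in between improves on [x]. *)
Lemma next_best_approx x :
  (exists2 w, w != 0 & D w < D x) -> best_approx Theta x ->
  exists x', [/\ best_approx Theta x', (nrm x < nrm x')%N, D x' < D x
    & forall w, w != 0 -> (nrm w < nrm x')%N -> D x <= D w].
Proof.
move=> [w w0 wx] xb.
have [|N /asboolP[u [u0 uN ux]] Nmin] :=
    @ex_minnP (fun N => `[< exists u, [/\ u != 0, nrm u = N & D u < D x] >]).
  by exists (nrm w); apply/asboolP; exists w.
have [|x' [x'b x'N x'min]] := @best_of_norm N.
  by rewrite -uN lt0n nrm_eq0.
have x'x : D x' < D x by apply: le_lt_trans ux; apply: x'min; rewrite ?uN.
have x'0 : x' != 0 by case: x'b.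
have x'E : nrm x' = N.
  by apply/eqP; rewrite eqn_leq x'N Nmin//; apply/asboolP; exists x'.
have far v : v != 0 -> (nrm v < N)%N -> D x <= D v.
  move=> v0 vN; rewrite leNgt; apply/negP => vx; move: vN; rewrite ltnNge.
  by rewrite Nmin//; apply/asboolP; exists v.
exists x'; split => //; last by rewrite x'E.
by rewrite ltnNge; apply/negP => /(best_approx_min xb x'0); rewrite leNgt x'x.
Qed.

Lemma best_approx_seq_lt z : best_approx_seq Theta z ->
  forall nu, (nrm (usubmx (z nu)) < nrm (usubmx (z nu.+1)))%N.
Proof. by move=> [_ zm _ _] nu; have := zm nu; rewrite !nrmE ltr_nat. Qed.

(** Both sequences run through the heights of all best approximations in increasing order, so their
    heights agree term by term; a term of [z'] occurs in [z] up to sign, and its height fixes the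
    position. *)
Lemma best_approx_seq_usub_unique z z' :
  best_approx_seq Theta z -> best_approx_seq Theta z' ->
  forall nu, usubmx (z' nu) = usubmx (z nu) \/ usubmx (z' nu) = - usubmx (z nu).
Proof.
move=> bz bz' nu.
have lt_z := best_approx_seq_lt bz; have lt_z' := best_approx_seq_lt bz'.
have inj : injective (fun k => nrm (usubmx (z k))).
  move=> i j /=; case: (ltngtP i j) => // /(increasing_lt lt_z) + E;
  by rewrite E ltnn.
have sub u v : best_approx_seq Theta u -> best_approx_seq Theta v ->
    forall i, exists j, nrm (usubmx (u i)) = nrm (usubmx (v j)).
  move=> [ub _ _ _] [_ _ _ vall] i.
  have [j [->|->]] := vall _ (ub i).1; exists j => //.
  by rewrite nrmN.
have E := increasing_same_range lt_z lt_z' (sub _ _ bz bz') (sub _ _ bz' bz).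
have [_ _ _ zall] := bz; have [zb' _ _ _] := bz'.
have [k h] := zall _ (zb' nu).1.
have nuk : nu = k; last by rewrite -nuk in h.
by apply: inj; rewrite /= E; case: h => ->; rewrite ?nrmN.
Qed.


(** A minimiser of [D] up to height [nrm w] is a best approximation, hence up to sign a term of
    index [mu]; its height forces [mu <= nu], and [D] decreases along the sequence. *)
Lemma best_approx_seq_min z nu w : best_approx_seq Theta z -> w != 0 ->
  (nrm w < nrm (usubmx (z nu.+1)))%N -> D (usubmx (z nu)) <= D w.
Proof.
move=> bz w0 wz; have lt_z := best_approx_seq_lt bz.
have w1 : (0 < nrm w)%N by rewrite lt0n nrm_eq0.
have [x [xb xw xmin]] := best_of_norm w1.
apply: le_trans (xmin _ w0 _) => //.
have [_ _ zD zall] := bz; have [mu xmu] := zall _ xb.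
have -> : D x = D (usubmx (z mu)) by case: xmu => ->; rewrite ?DN.
have nx : nrm x = nrm (usubmx (z mu)) by case: xmu => ->; rewrite ?nrmN.
have munu : (mu <= nu)%N.
  rewrite leqNgt; apply/negP => numu.
  have : (nrm (usubmx (z nu.+1)) <= nrm (usubmx (z mu)))%N.
    move: numu; rewrite leq_eqVlt => /orP[/eqP->//|/(increasing_lt lt_z)].
    exact: ltnW.
  by rewrite -nx leqNgt (leq_ltn_trans xw wz).
have dec i j : (i <= j)%N -> D (usubmx (z j)) <= D (usubmx (z i)).
  move/subnK => <-; elim: (j - i)%N => // k IH.
  by rewrite addSn; exact: le_trans (ltW (zD _)) IH.
exact: dec.
Qed.

Hypothesis tiny : forall e, 0 < e -> exists2 w, w != 0 & D w < e.

(** Iterate [next_best_approx] from height 1. Since [D] is positive but takes arbitrarily small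
    values, the iteration never stops. *)
Lemma best_approx_seq_exists : exists z, best_approx_seq Theta z.
Proof.
have [x0 [x0b x01 _]] := @best_of_norm 1 isT.
have /choice[nx nxP] : forall x, exists x', best_approx Theta x ->
    [/\ best_approx Theta x', (nrm x < nrm x')%N, D x' < D x
    & forall w, w != 0 -> (nrm w < nrm x')%N -> D x <= D w].
  move=> x; have [xb|nxb] := pselect (best_approx Theta x); last by exists x.
  have [x' h] := next_best_approx (tiny (dist_gt0 n0 Tfree xb.1)) xb.
  by exists x'.
pose s k := iter k nx x0.
have sb k : best_approx Theta (s k).
  by elim: k => // k IH; have [] := nxP _ IH.
have slt k : (nrm (s k) < nrm (s k.+1))%N by have [] := nxP _ (sb k).
have sD k : D (s k.+1) < D (s k) by have [] := nxP _ (sb k).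
exists (fun k => col_mx (s k) (nearestv (Theta *m intv R (s k)))).
split=> [nu|nu|nu|x xb]; rewrite ?col_mxKu.
- by split; rewrite col_mxKu ?col_mxKd// nearestvP.
- by rewrite !nrmE ltr_nat.
- exact: sD.
(* If [x] is not the term below it up to sign, being best gives [D x < D (s nu)], against the fact
   that nothing improves before [s nu.+1]. *)
have [nu /andP[h1 h2]] : exists k, (nrm (s k) <= nrm x < nrm (s k.+1))%N.
  apply: (increasing_locate slt); apply: leq_trans x01 _.
  by rewrite lt0n nrm_eq0; case: xb.
exists nu; rewrite col_mxKu.
have [->|xs] := eqVneq x (s nu); first by left.
have [->|xNs] := eqVneq x (- s nu); first by right.
have [_ _ _ far] := nxP _ (sb nu).
have := far _ xb.1 h2; rewrite leNgt.
have /best_approxE[_ ->//] := xb; first by case: (sb nu).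
- by rewrite eq_sym.
- by apply: contra_neq xNs => ->; rewrite opprK.
Qed.

Lemma good_of_lin_free : good Theta.
Proof.
have [z bz] := best_approx_seq_exists; exists z; split => // z' bz' nu.
have [/(_ nu)[zb zy] _ _ _] := bz; have [/(_ nu)[zb' zy'] _ _ _] := bz'.
rewrite -[z' nu]vsubmxK -[z nu]vsubmxK opp_col_mx.
case: (best_approx_seq_usub_unique bz bz' nu) => E; rewrite E in zy' *.
  by left; congr col_mx; apply: nearest_unique zy' zy => //; case: zb.
right; congr col_mx; apply: oppr_inj; rewrite opprK.
apply: nearest_unique (zy) => //; first by case: zb.
rewrite -[RHS]/(D _) -DN /D -zy' -[LHS]normrN.
by rewrite !intvN mulmxN opprD !opprK.
Qed.

End BestApproximations.

(** * The dimension of the best approximations *)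

Definition supp2 m (x : 'cV[int]_m) := forall j : 'I_m, (1 < j)%N -> x j 0 = 0.

(** The ranks of the finite stacks [M k] are bounded, so from one of maximal rank on the row space
    is constant; a vector killed by that stack is killed by every [w i]. *)
Lemma rational_annihilator d p (w : nat -> 'rV[rat]_d) (A : 'M[rat]_(p, d)) :
  (forall k, \rank (col_mx (\matrix_(i < k) w i) A) < d)%N ->
  exists phi : 'cV_d, [/\ phi != 0, A *m phi = 0 & forall i, w i *m phi = 0].
Proof.
pose M k := col_mx (\matrix_(i < k) w i) A => rkM.
have [||_ /asboolP[k <-] kmax] :=
    @ex_maxnP (fun r => `[< exists k, \rank (M k) = r >]) d.
- by exists (\rank (M 0)); apply/asboolP; exists 0%N.
- by move=> _ /asboolP[k <-]; exact: ltnW.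
have [j phi0] : exists j, col j (cokermx (M k)) != 0.
  apply/existsP; apply: contraT; rewrite negb_exists => /forallP h.
  have : \rank (cokermx (M k)) = 0%N.
    apply/eqP; rewrite mxrank_eq0; apply/eqP/matrixP => i j; rewrite mxE.
    by have := h j; rewrite negbK => /eqP/matrixP/(_ i 0); rewrite !mxE.
  by rewrite mxrank_coker => /eqP; rewrite subn_eq0 leqNgt rkM.
have Mle i l : (i <= l)%N -> (M i <= M l)%MS.
  move=> il; rewrite /M col_mx_sub; apply/andP; split; last first.
    by rewrite -addsmxE addsmxSr.
  apply/row_subP => i'; rewrite rowK -addsmxE.
  apply: submx_trans (addsmxSl _ _); have i'l := leq_trans (ltn_ord i') il.
  rewrite (_ : w i' = row (Ordinal i'l) (\matrix_(i < l) w i)).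
    exact: row_sub.
  by rewrite rowK.
have Mphi l : M l *m col j (cokermx (M k)) = 0.
  have h : (M (maxn k l) <= M k)%MS.
    have /leqifP := mxrank_leqif_sup (Mle _ _ (leq_maxl k l)).
    case: ifP => // _; rewrite ltnNge kmax//.
    by apply/asboolP; exists (maxn k l).
  have /submxP[C ->] := submx_trans (Mle _ _ (leq_maxr k l)) h.
  by rewrite -mulmxA colE (mulmxA (M k)) mulmx_coker mul0mx mulmx0.
exists (col j (cokermx (M k))); split => //.
  by have /eqP := Mphi 0%N; rewrite mul_col_mx col_mx_eq0 => /andP[_ /eqP].
move=> i; have /eqP := Mphi i.+1.
rewrite mul_col_mx col_mx_eq0 => /andP[/eqP/(congr1 (row ord_max)) + _].
by rewrite row_mul rowK linear0.
Qed.

Lemma rank_vspace (F : fieldType) d k (U : {vspace 'cV[F]_d}) (A : 'M[F]_(k, d)) :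
  (forall i, (row i A)^T \in U) -> (\rank A <= \dim U)%N.
Proof.
move=> AU; pose B := \matrix_(l < \dim U) ((vbasis U)`_l)^T.
have -> : A = (\matrix_(i, l) coord (vbasis U) l (row i A)^T) *m B.
  apply/row_matrixP => i; rewrite row_mul mulmx_sum_row.
  apply: trmx_inj; rewrite {1}(coord_vbasis (AU i)) linear_sum /=.
  by apply: eq_bigr => l _; rewrite !mxE linearZ /= rowK trmxK.
exact: leq_trans (mxrankM_maxr _ _) (rank_leq_row _).
Qed.

Lemma intv_col (R : realType) m n (z : 'cV[int]_(m + n)) :
  intv R z = col_mx (intv R (usubmx z)) (intv R (dsubmx z)).
Proof. by rewrite /intv -map_col_mx vsubmxK. Qed.

Section Dimension.
Variables (R : realType) (m n : nat) (Theta : 'M[R]_(n, m.+2)).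
Hypothesis Tfree : lin_free Theta.
Let D (x : 'cV[int]_m.+2) := dist_int (Theta *m intv R x).

Variable z : nat -> 'cV[int]_(m.+2 + n).
Hypothesis bz : best_approx_seq Theta z.
Hypothesis zsupp : exists nu0, forall nu, (nu0 <= nu)%N -> supp2 (usubmx (z nu)).

Lemma eventually_in_dim_supp2 : eventually_in_dim R z (n + 2).
Proof.
(* [P] includes the coordinates (x_0, x_1, y) into the whole space and [Q] reads them off; the range
   of [P] is the required subspace. *)
pose P : 'M[R]_(m.+2 + n, 2 + n) := block_mx (pid_mx 2) 0 0 1%:M.
pose Q : 'M[R]_(2 + n, m.+2 + n) := block_mx (pid_mx 2) 0 0 1%:M.
have QP : Q *m P = 1%:M.
  rewrite mulmx_block !mulmx0 !mul0mx !addr0 !add0r mulmx1 pid_mx_id//.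
  by rewrite pid_mx_1 scalar_mx_block.
pose f := linfun (mulmx P : 'cV[R]_(2 + n) -> 'cV[R]_(m.+2 + n)).
exists (limg f); split.
  rewrite limg_dim_eq ?dimvf; first by rewrite dim_matrix; lia.
  apply/eqP; rewrite -subv0 capfv; apply/subvP => v.
  rewrite memv_ker memv0 lfunE /= => /eqP Pv.
  by rewrite -[v]mul1mx -QP -mulmxA Pv mulmx0.
have [nu0 h] := zsupp; exists nu0 => nu /h sx; apply/memv_imgP.
exists (Q *m intv R (z nu)); first exact: memvf.
rewrite lfunE /= mulmxA mulmx_block !mulmx0 !mul0mx !addr0 !add0r mulmx1.
rewrite intv_col mul_block_col !mul0mx mul1mx addr0 add0r.
congr col_mx; apply/matrixP => i j; rewrite pid_mx_id// ord1 !mxE.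
rewrite (bigD1 i)//= !mxE eqxx /= [X in _ + X]big1 ?addr0.
  by case: ltnP => [_|/sx]; rewrite ?mul1r// !mxE => ->; rewrite mulr0.
by move=> l /negbTE li; rewrite !mxE eq_sym -val_eqE /= in li *; rewrite li mul0r.
Qed.

Hypothesis zsmall : forall e, 0 < e -> exists nu0, forall nu, (nu0 <= nu)%N ->
  D (usubmx (z nu)) * (nrm (usubmx (z nu.+1)))%:R < e.

Lemma sum_supp2 (g : 'rV[R]_m.+2) x : supp2 x ->
  (g *m intv R x) 0 0 = g 0 0 * (x 0 0)%:~R + g 0 1 * (x 1 0)%:~R.
Proof.
move=> sx; rewrite mxE 2!big_ord_recl big1 ?addr0 => [|i _].
  by rewrite !mxE (_ : lift ord0 ord0 = 1)//; exact: val_inj.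
by rewrite !mxE sx// mulr0.
Qed.

Lemma small_int (t : int) : `|t%:~R| < 1 :> R -> t = 0.
Proof. by rewrite -intr_norm (ltr_int R _ 1); lia. Qed.

Lemma ord_supp2 x (i : 'I_m.+2) : supp2 x -> x i 0 != 0 -> i = 0 \/ i = 1.
Proof.
move=> sx; case: i => -[|[|i]] lti; [left|right|]; try exact: val_inj.
by rewrite sx ?eqxx.
Qed.

(** Otherwise x and x' are parallel, smallness of the product makes their extended vectors parallel
    too, and the error vectors scale by the same ratio. As x' is longer than x, its error is then at
    least that of x, a contradiction. *)
Lemma consecutive_not_parallel nu :
  supp2 (usubmx (z nu)) -> supp2 (usubmx (z nu.+1)) ->
  usubmx (z nu) 0 0 * usubmx (z nu.+1) 1 0 =
    usubmx (z nu) 1 0 * usubmx (z nu.+1) 0 0 ->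
  2^-1 <= D (usubmx (z nu)) * (nrm (usubmx (z nu.+1)))%:R.
Proof.
have [zb _ zD _] := bz; have zlt := best_approx_seq_lt bz.
have [[x0 _] zy] := zb nu; have [_ zy'] := zb nu.+1.
have {zD} := zD nu; have {zlt} := zlt nu.
move: x0 zy zy'; rewrite /D.
move: (usubmx (z nu)) (usubmx (z nu.+1)) (dsubmx (z nu)) (dsubmx (z nu.+1)).
move=> x x' y y'; set ep := Theta *m intv R x - intv R y.
set ep' := Theta *m intv R x' - intv R y' => x0 epE ep'E xx' ep_lt sx sx' det.
rewrite leNgt; apply/negP => small.
have [i xi0] : exists i, x i 0 != 0.
  apply/existsP; apply: contraT; rewrite negb_exists => /forallP h.
  case/eqP: x0; apply/matrixP => i j; rewrite ord1 mxE; apply/eqP.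
  by have := h i; rewrite negbK.
have par : x i 0 *: x' = x' i 0 *: x.
  apply/matrixP => j k; rewrite ord1 !mxE.
  case: j => -[|[|j']] ltj; 
    last by rewrite (sx (Ordinal ltj))// (sx' (Ordinal ltj))// !mulr0.
    rewrite (_ : Ordinal ltj = 0); last exact: val_inj.
    by have [->|->] := ord_supp2 sx xi0; rewrite -?det mulrC.
  rewrite (_ : Ordinal ltj = 1); last exact: val_inj.
  by have [->|->] := ord_supp2 sx xi0; rewrite ?det mulrC.
have parR : (x i 0)%:~R *: intv R x' = (x' i 0)%:~R *: intv R x.
  have := congr1 (@intv R _) par; rewrite /intv => /matrixP h.
  by apply/matrixP => j k; have := h j k; rewrite !mxE !rmorphM.
have leN (u : 'cV[int]_m.+2) : `|(u i 0)%:~R| <= (nrm u)%:R :> R.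
  by rewrite -nrmE; have := ler_mxnorm (intv R u) i 0; rewrite mxE.
have xx'R : (nrm x)%:R < (nrm x')%:R :> R by rewrite ltr_nat.
have xpos : 0 < `|(x i 0)%:~R| :> R by rewrite normr_gt0 intr_eq0.
have ep0 : 0 <= `|ep| by []; have ep'0 : 0 <= `|ep'| by [].
(* The difference of the two sides is, up to sign, an integer combination of y and y'; each side has
   norm below 1/2, so this integer vector vanishes. *)
have epE2 : (x i 0)%:~R *: ep' = (x' i 0)%:~R *: ep.
  have pary : (x i 0)%:~R *: intv R y' - (x' i 0)%:~R *: intv R y
      = (x' i 0)%:~R *: ep - (x i 0)%:~R *: ep'.
    by rewrite /ep /ep' !scalerBr !scalemxAr parR opprB [RHS]addrC addrA subrK.
  apply/eqP; rewrite eq_sym -subr_eq0 -pary; apply/eqP/matrixP => l k.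
  rewrite ord1 [RHS]mxE.
  have E : (x i 0 * y' l 0 - x' i 0 * y l 0)%:~R =
      ((x i 0)%:~R *: intv R y' - (x' i 0)%:~R *: intv R y) l 0.
    by rewrite !mxE rmorphB /= !rmorphM.
  rewrite -E (@small_int (x i 0 * y' l 0 - x' i 0 * y l 0))// E pary.
  apply: le_lt_trans (ler_mxnorm _ _ _) _; apply: le_lt_trans (ler_normB _ _) _.
  rewrite !normrZ; rewrite -epE in small ep_lt; rewrite -ep'E in ep_lt.
  have l1 : `|(x' i 0)%:~R| * `|ep| <= `|ep| * (nrm x')%:R.
    by rewrite mulrC ler_wpM2l.
  have l2 : `|(x i 0)%:~R| * `|ep'| <= `|ep| * (nrm x')%:R.
    rewrite mulrC ler_pM// ?ltW//.
    by apply: le_lt_trans (leN x) _.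
  lra.
have := congr1 Num.Def.normr epE2; rewrite !normrZ => E1.
have := congr1 Num.Def.normr parR; rewrite !normrZ !nrmE => E2.
rewrite -epE -ep'E in ep_lt.
have l1 : `|(x i 0)%:~R| <= `|(x' i 0)%:~R| :> R.
  rewrite leNgt; apply/negP => lt.
  have : `|(x' i 0)%:~R| * (nrm x)%:R <= `|(x i 0)%:~R| * (nrm x)%:R :> R.
    by rewrite ler_wpM2r// ltW.
  by rewrite -E2 ler_pM2l// leNgt xx'R.
have : `|(x i 0)%:~R| * `|ep| <= `|(x' i 0)%:~R| * `|ep| by rewrite ler_wpM2r.
by rewrite -E1 ler_pM2l// leNgt ep_lt.
Qed.

(** The rows of [A] read off the coordinates x_j with [1 < j] and have rank [m]; stacked under the
    tail they still give rank below [m + 2 + n]. The condition [A *m phi = 0] makes [phi] a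
    nontrivial functional on the (n+2)-dimensional coordinate subspace. *)
Lemma best_approx_annihilator U : (\dim U < n + 2)%N ->
  (exists nu0, forall nu, (nu0 <= nu)%N -> intv R (z nu) \in U) ->
  exists phi : 'cV[rat]_(m.+2 + n), [/\ phi != 0,
    forall j : 'I_m.+2, (1 < j)%N -> usubmx phi j 0 = 0 &
    exists nu0, forall nu, (nu0 <= nu)%N ->
      (map_mx intr (z nu))^T *m phi = 0].
Proof.
move=> dU [nu0 zU].
pose w k : 'rV[rat]_(m.+2 + n) := (map_mx intr (z (nu0 + k)%N))^T.
pose A : 'M[rat]_(m.+2, m.+2 + n) := row_mx (copid_mx 2) 0.
have [k|phi [phi0 Aphi wphi]] := @rational_annihilator _ _ w A.
  rewrite -addsmxE; apply: leq_ltn_trans (mxrank_adds_leqif _ _).1 _.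
  rewrite rank_row_mx0 rank_copid_mx//.
  suff : (\rank (\matrix_(i < k) w i) <= \dim U)%N by lia.
  rewrite -(mxrank_map (@ratr R)); apply: rank_vspace => i.
  rewrite (_ : _^T = intv R (z (nu0 + i)%N)); first by rewrite zU ?leq_addr.
  by apply/matrixP => j l; rewrite !mxE /= ratr_int ord1.
exists phi; split => //.
  move=> j j1; have := congr1 (fun u : 'cV[rat]_m.+2 => u j 0) Aphi.
  rewrite /= -{1}[phi]vsubmxK mul_row_col mul0mx addr0 mulmxBl mul1mx.
  rewrite [RHS]mxE => <-; rewrite [in RHS]mxE [X in _ = _ + X]mxE.
  rewrite [X in _ = _ - X]mxE big1 ?subr0// => l _.
  by rewrite mxE [(j < 2)%N]ltnNge j1 andbF mul0r.
exists nu0 => nu nu0nu; rewrite -(subnKC nu0nu); exact: wphi.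
Qed.

Lemma best_approx_dim_ge s : eventually_in_dim R z s -> (n + 2 <= s)%N.
Proof.
move=> [U [<- Uz]]; rewrite leqNgt; apply/negP => dU.
have [phi [phi0 phi2 [nu1 zphi]]] := best_approx_annihilator dU Uz.
pose al : 'cV[R]_m.+2 := map_mx ratr (usubmx phi).
pose be : 'cV[R]_n := map_mx ratr (dsubmx phi).
(* Replacing y by [Theta x] in the functional: [g] applied to x measures only the error of
   approximation, so it is [O(D x)] on the tail. *)
pose g : 'rV[R]_m.+2 := al^T + be^T *m Theta.
have gz nu : (nu1 <= nu)%N -> g *m intv R (usubmx (z nu)) =
    be^T *m (Theta *m intv R (usubmx (z nu)) - intv R (dsubmx (z nu))).
  move=> /zphi /(congr1 (map_mx (@ratr R))); rewrite map_mxM map_mx0 /=.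
  rewrite -{1}[phi]vsubmxK map_col_mx -/al -/be => E.
  have {}E : al^T *m intv R (usubmx (z nu)) + be^T *m intv R (dsubmx (z nu)) = 0.
    rewrite -mul_row_col -tr_col_mx -intv_col; apply: trmx_inj.
    rewrite trmx_mul trmxK trmx0 -E; congr (_ *m _).
    by apply/matrixP => i j; rewrite !mxE ratr_int.
  rewrite mulmxDl mulmxBr mulmxA -[LHS]subr0 -E opprD addrACA subrr add0r.
  by rewrite addrC.
pose C := \sum_i `|be i 0|.
have C0 : 0 <= C by apply: sumr_ge0.
have gD nu : (nu1 <= nu)%N ->
    `|(g *m intv R (usubmx (z nu))) 0 0| <= C * D (usubmx (z nu)).
  move=> /gz ->; have [/(_ nu)[_ /=] zE _ _ _] := bz; rewrite /D -zE mxE.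
  apply: le_trans (ler_norm_sum _ _ _) _; rewrite mulr_suml.
  apply: ler_sum => i _; rewrite normrM mxE.
  by rewrite ler_wpM2l// ler_mxnorm.
(* If the y-part of [phi] is zero, [g] is its x-part, supported on 0 and 1; otherwise the entry of
   [g] at 0 is a nontrivial linear form in the entries of [Theta]. *)
have [j [j01 gj]] : exists j : 'I_m.+2, (j = 0 \/ j = 1) /\ g 0 j != 0.
  have [be0|be0] := eqVneq (dsubmx phi) 0.
    have [j alj] : exists j, usubmx phi j 0 != 0.
      apply/existsP; apply: contraT; rewrite negb_exists => /forallP h.
      case/eqP: phi0; rewrite -[phi]vsubmxK be0 -[0 in RHS]vsubmxK.
      rewrite !linear0; congr col_mx; apply/matrixP => i j.
      by rewrite ord1 [RHS]mxE; apply/eqP; have := h i; rewrite negbK.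
    exists j; split; last first.
      rewrite mxE mxE /be be0 map_mx0 trmx0 mul0mx [X in _ + X]mxE addr0.
      by rewrite mxE fmorph_eq0.
    case: j alj => -[|[|j]] lj alj; last by rewrite phi2 ?eqxx in alj.
      by left; apply: val_inj.
    by right; apply: val_inj.
  exists 0; split; first by left.
  pose B : 'M[rat]_(n, m.+2) := \matrix_(i, j) (dsubmx phi i 0 * (j == 0)%:R).
  have <- : lin_form B (usubmx phi 0 0) Theta = g 0 0.
    rewrite /lin_form addrC [RHS]mxE; congr (_ + _); first by rewrite !mxE.
    rewrite mxE; apply: eq_bigr => i _; rewrite (bigD1 0)//= big1 ?addr0.
      by rewrite !mxE eqxx mulr1.
    by move=> l /negbTE l0; rewrite mxE l0 mulr0 rmorph0 mul0r.
  apply: Tfree; apply: contra_neq be0 => B0.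
  apply/matrixP => i l; have := congr1 (fun M : 'M[rat]_(n, m.+2) => M i 0) B0.
  by rewrite ord1 !mxE eqxx mulr1.
(* The bound 1/2 excludes parallel neighbours; the other one makes [2 * C] times the product smaller
   than [|g 0 j|]. *)
have e0 : 0 < Num.min 2^-1 (`|g 0 j| / (2 * C + 1)).
  rewrite lt_min invr_gt0 ltr0n /= divr_gt0 ?normr_gt0//; lra.
have [nu2 small] := zsmall e0; have [nu3 sz] := zsupp.
pose nu := maxn nu1 (maxn nu2 nu3).
have [le1 le2 le3] : [/\ (nu1 <= nu)%N, (nu2 <= nu)%N & (nu3 <= nu)%N].
  by rewrite /nu; split; lia.
have sx := sz _ le3; have sx' := sz _ (leqW le3).
have := small _ le2; rewrite lt_min => /andP[lt_half lt_g].
have := consecutive_not_parallel sx sx'; rewrite leNgt lt_half => np.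
suff /np : usubmx (z nu) 0 0 * usubmx (z nu.+1) 1 0 =
    usubmx (z nu) 1 0 * usubmx (z nu.+1) 0 0 by [].
have := gD _ le1; have := gD _ (leqW le1); rewrite !sum_supp2//.
have [_ _ /(_ nu) zD _] := bz; have := best_approx_seq_lt bz nu.
move: zD lt_g; rewrite -/(D _) -/(D _).
have leN (u : 'cV[int]_m.+2) i : `|(u i 0)%:~R| <= (nrm u)%:R :> R.
  by rewrite -nrmE; have := ler_mxnorm (intv R u) i 0; rewrite mxE.
set x := usubmx (z nu); set x' := usubmx (z nu.+1) => DD lt_g xx' gx' gx.
have xx'R : (nrm x)%:R <= (nrm x')%:R :> R by rewrite ler_nat ltnW.
apply/eqP; rewrite -subr_eq0; apply/eqP; apply: small_int.
rewrite rmorphB /= !rmorphM /=.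
set u := g 0 0 * _ + _ in gx; set u' := g 0 0 * _ + _ in gx'.
(* Cramer's rule: for [i = 1] the left side is [|g 0 0|] times the absolute determinant of x and x',
   for [i = 0] it is [|g 0 1|] times it. So the integer determinant is less than 1 in absolute
   value. *)
have bound i : `|u * (x' i 0)%:~R - u' * (x i 0)%:~R| < `|g 0 j|.
  apply: le_lt_trans (ler_normB _ _) _; rewrite !normrM.
  have l1 : `|u| * `|(x' i 0)%:~R| <= C * D x * (nrm x')%:R by rewrite ler_pM.
  have l2 : `|u'| * `|(x i 0)%:~R| <= C * D x * (nrm x')%:R.
    rewrite ler_pM//; last exact: le_trans (leN x i) _.
    by apply: le_trans gx' _; rewrite ler_wpM2l// ltW.
  rewrite ltr_pdivlMr in lt_g; last by lra.
  have : 0 <= D x * (nrm x')%:R by rewrite mulr_ge0// dist_int_ge0.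
  move: l1 l2; rewrite -mulrA; move: (D x * _) lt_g => t lt_g l1 l2 t0.
  lra.
suff : `|g 0 j| * `|(x 0 0)%:~R * (x' 1 0)%:~R - (x 1 0)%:~R * (x' 0 0)%:~R|
    < `|g 0 j|.
  by rewrite gtr_pMr ?normr_gt0.
rewrite -normrM; case: j01 => jE.
  apply: le_lt_trans (bound 1); rewrite jE le_eqVlt; apply/orP; left; apply/eqP.
  by congr `|_|; rewrite /u /u'; ring.
apply: le_lt_trans (bound 0); rewrite distrC jE le_eqVlt; apply/orP; left; apply/eqP.
by congr `|_|; rewrite /u /u'; ring.
Qed.

End Dimension.

(** * Generic polynomial conditions *)

(** Polynomial functions of the entries, given by closure so that continuity and polynomiality along
    lines follow by induction. *)
Inductive polyfun (R : realType) m n : ('M[R]_(n, m) -> R) -> Prop :=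
| polyfun_cst c : polyfun (fun=> c)
| polyfun_coord i j : polyfun (fun T => T i j)
| polyfun_add f g : polyfun f -> polyfun g -> polyfun (fun T => f T + g T)
| polyfun_mul f g : polyfun f -> polyfun g -> polyfun (fun T => f T * g T).

Section PolyFun.
Variables (R : realType) (m n : nat).
Implicit Types f : 'M[R]_(n, m) -> R.

Lemma polyfun_sum (I : Type) (r : seq I) (F : I -> 'M[R]_(n, m) -> R) :
  (forall i, polyfun (F i)) -> polyfun (fun T => \sum_(i <- r) F i T).
Proof.
move=> pF; elim: r => [|i r IH].
  by under eq_fun do rewrite big_nil; exact: polyfun_cst.
by under eq_fun do rewrite big_cons; exact: polyfun_add.
Qed.

Lemma polyfun_prod (I : Type) (r : seq I) (F : I -> 'M[R]_(n, m) -> R) :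
  (forall i, polyfun (F i)) -> polyfun (fun T => \prod_(i <- r) F i T).
Proof.
move=> pF; elim: r => [|i r IH].
  by under eq_fun do rewrite big_nil; exact: polyfun_cst.
by under eq_fun do rewrite big_cons; exact: polyfun_mul.
Qed.

Lemma polyfun_continuous f : polyfun f -> continuous f.
Proof.
elim=> [c|i j|g h _ cg _ ch|g h _ cg _ ch] A.
- exact: cst_continuous.
- exact: coord_continuous.
- exact: cvgD (cg A) (ch A).
- exact: cvgM (cg A) (ch A).
Qed.

Lemma polyfun_line f A B : polyfun f ->
  exists p : {poly R}, forall t, f (A + t *: B) = p.[t].
Proof.
elim=> [c|i j|g h _ [p pE] _ [q qE]|g h _ [p pE] _ [q qE]].
- by exists c%:P => t; rewrite hornerC.
- by exists ((A i j)%:P + (B i j) *: 'X) => t; rewrite !mxE !hornerE mulrC.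
- by exists (p + q) => t; rewrite hornerD pE qE.
- by exists (p * q) => t; rewrite hornerM pE qE.
Qed.

(** Split off the power of X dividing [p]: the cofactor does not vanish at 0, hence not nearby, and
    the power vanishes only at 0. *)
Lemma near_poly_neq0 (p : {poly R}) : p != 0 ->
  \forall t \near 0^'+, p.[t] != 0.
Proof.
move=> p0; have [k [q + pE]] := multiplicity_XsubC p 0.
rewrite p0 /= => q0.
have qn : \forall t \near (0 : R)^'+, q.[t] != 0.
  have qc : horner q @ (0 : R)^'+ --> q.[0].
    by apply: cvg_at_right_filter; exact: continuous_horner.
  exact: cvgr_neq0 qc q0.
near=> t; rewrite pE subr0 hornerM horner_exp hornerX mulf_neq0//.
  by near: t.
by rewrite expf_neq0// gt_eqF//; near: t; exact: nbhs_right_gt.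
Unshelve. all: by end_near. Qed.

(** The value at [t = 1] shows that the restriction to the line is a nonzero polynomial. This is how
    a zero set is left by an arbitrarily small move. *)
Lemma polyfun_near_line f A B : polyfun f -> f (A + B) != 0 ->
  \forall t \near 0^'+, f (A + t *: B) != 0.
Proof.
move=> /(polyfun_line A B)[p pE]; rewrite -[B in f (A + B)]scale1r pE => p1.
have p0 : p != 0 by apply: contra_neq p1 => ->; rewrite horner0.
by apply: filterS (near_poly_neq0 p0) => t; rewrite pE.
Qed.

Lemma polyfun_lin_form C c : polyfun (@lin_form R m n C c).
Proof.
apply: polyfun_add; last exact: polyfun_cst.
apply: polyfun_sum => i; apply: polyfun_sum => j.
by apply: polyfun_mul; [exact: polyfun_cst|exact: polyfun_coord].
Qed.

(** [B *m c] lies on the graph of [T] exactly when this matrix kills [c], so a nonzero determinant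
    means that no nonzero [c] is sent into the graph. *)
Definition graph_det (B : 'M[R]_(m + n, n)) (T : 'M[R]_(n, m)) : R :=
  \det (dsubmx B - T *m usubmx B).

Lemma polyfun_graph_det B : polyfun (graph_det B).
Proof.
apply: polyfun_sum => s; apply: polyfun_mul; first exact: polyfun_cst.
apply: polyfun_prod => i; rewrite (_ : (fun T => _) = fun T : 'M[R]_(n, m) =>
  dsubmx B i (s i) + -1 * \sum_j T i j * usubmx B j (s i)).
  apply: polyfun_add; first exact: polyfun_cst.
  apply: polyfun_mul; first exact: polyfun_cst.
  apply: polyfun_sum => j.
  by apply: polyfun_mul; [exact: polyfun_coord|exact: polyfun_cst].
by apply/funext => T; rewrite !mxE mulN1r; congr (_ - _); rewrite mxE.
Qed.

End PolyFun.

(* As long as M = B_y - T B_x is singular its rank can be increased: subtracting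
   from T a rank-one matrix with range outside that of M shrinks the kernel. *)
Lemma graph_det_neq0 (R : realType) m n (B : 'M[R]_(m + n, n)) :
  row_free B^T -> exists T, graph_det B T != 0.
Proof.
move=> Bfree; pose M T := dsubmx B - T *m usubmx B.
have [||_ /asboolP[T <-] Tmax] :=
    @ex_maxnP (fun r => `[< exists T, \rank (M T) = r >]) n.
- by exists (\rank (M 0)); apply/asboolP; exists 0.
- by move=> _ /asboolP[T <-]; exact: rank_leq_row.
exists T; rewrite /graph_det -/(M T) -unitfE -unitmxE -row_free_unit.
apply: contraT => notfree.
have /rowV0Pn[v vker v0] : kermx (M T)^T != 0.
  by rewrite kermx_eq0 row_free_unit unitmx_tr -row_free_unit.
have Mv : M T *m v^T = 0.
  by apply: trmx_inj; rewrite trmx_mul trmxK trmx0; exact/sub_kermxP.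
(* If B_x v were zero, then M v = 0 would give B_y v = 0 as well, against the independence of the
   columns of [B]. *)
have [j xj] : exists j, (usubmx B *m v^T) j 0 != 0.
  apply/existsP; apply: contraT; rewrite negb_exists => /forallP h.
  have xv : usubmx B *m v^T = 0.
    apply/matrixP => i l; rewrite ord1 [RHS]mxE; apply/eqP.
    by have := h i; rewrite negbK.
  have yv : dsubmx B *m v^T = 0.
    by move: Mv; rewrite mulmxBl -mulmxA xv mulmx0 subr0.
  have : v *m B^T = 0.
    apply: trmx_inj; rewrite trmx_mul !trmxK trmx0 -[B]vsubmxK mul_col_mx xv yv.
    by rewrite col_mx0.
  by move/eqP; rewrite mulmx_free_eq0// (negbTE v0).
have [u uM] : exists u : 'rV[R]_n, ~~ (u <= (M T)^T)%MS.
  have : ~~ (1%:M <= (M T)^T)%MS.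
    by rewrite sub1mx /row_full mxrank_tr.
  by move/row_subPn => [i ui]; exists (row i 1%:M).
pose T' := T - u^T *m delta_mx 0 j.
have ME : M T' = M T + u^T *m row j (usubmx B).
  by rewrite /M /T' mulmxBl -mulmxA -rowE opprB addrA addrAC.
have kerlt : (kermx (M T')^T < kermx (M T)^T)%MS.
  apply/andP; split; last first.
    apply/negP => /(submx_trans vker)/sub_kermxP/(congr1 trmx).
    rewrite trmx_mul trmxK trmx0 ME mulmxDl Mv add0r -mulmxA -row_mul => E.
    have : u^T != 0.
      apply: contraNneq uM => /(congr1 trmx); rewrite trmxK trmx0 => ->.
      exact: sub0mx.
    case/negP; apply/eqP/matrixP => i l; rewrite ord1 [RHS]mxE.
    move/matrixP: E => /(_ i 0); rewrite mxE big_ord1 [RHS]mxE => /eqP.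
    by rewrite mulf_eq0 [in X in _ || X]mxE (negbTE xj) orbF => /eqP.
  apply/rV_subP => w /sub_kermxP/(congr1 trmx).
  rewrite trmx_mul trmxK trmx0 ME mulmxDl -mulmxA => E.
  pose c := (row j (usubmx B) *m w^T) 0 0.
  have cE : row j (usubmx B) *m w^T = c%:M by rewrite [LHS]mx11_scalar.
  rewrite cE mul_mx_scalar in E.
  have [c0|c0] := eqVneq c 0.
    rewrite c0 scale0r addr0 in E; apply/sub_kermxP; apply: trmx_inj.
    by rewrite trmx_mul trmxK trmx0.
  case/negP: uM; have -> : u = (- c^-1 *: w) *m (M T)^T.
    apply: trmx_inj; rewrite trmx_mul trmxK linearZ /= -scalemxAr.
    move/eqP: E; rewrite addr_eq0 => /eqP ->.
    by rewrite scalerN scaleNr opprK scalerA mulVf// scale1r.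
  exact: submxMl.
have := rank_ltmx kerlt; rewrite !mxrank_ker !mxrank_tr.
have : (\rank (M T') <= \rank (M T))%N by apply: Tmax; apply/asboolP; exists T'.
have := rank_leq_row (M T); lia.
Qed.

(** * The countable family of polynomials to be avoided *)

Section GenericFamily.
Variables (R : realType) (m n : nat).

(** Linear forms account for independence of the entries, integer matrices for bases of rational
    subspaces of dimension [n]. *)
Definition generic_index : countType :=
  ('M[rat]_(n, m) * rat + 'M[int]_(m + n, n))%type.

Definition generic_fun (i : generic_index) : 'M[R]_(n, m) -> R :=
  match i with
  | inl Cc => lin_form Cc.1 Cc.2
  | inr B => graph_det (map_mx intr B)
  end.

(** The constant 1 replaces undecodable indices and identically vanishing members, so that every
    term is nonzero somewhere. *)
Definition generic_seq (k : nat) : 'M[R]_(n, m) -> R :=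
  match unpickle k : option generic_index with
  | Some i => if `[< exists T, generic_fun i T != 0 >] then generic_fun i
              else fun=> 1
  | None => fun=> 1
  end.

Lemma polyfun_generic_seq k : polyfun (generic_seq k).
Proof.
rewrite /generic_seq; case: unpickle => [i|]; last exact: polyfun_cst.
case: asboolP => _; last exact: polyfun_cst.
by case: i => [Cc|B]; [exact: polyfun_lin_form|exact: polyfun_graph_det].
Qed.

Lemma generic_seq_neq0 k : exists T, generic_seq k T != 0.
Proof.
rewrite /generic_seq; case: unpickle => [i|]; last by exists 0; rewrite oner_neq0.
by case: asboolP => // _; exists 0; rewrite oner_neq0.
Qed.

Lemma generic_seqP T i : (forall k, generic_seq k T != 0) ->
  (exists T', generic_fun i T' != 0) -> generic_fun i T != 0.
Proof.
by move=> /(_ (pickle i)); rewrite /generic_seq pickleK => + h; rewrite asboolT.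
Qed.

Lemma generic_lin_free T : (forall k, generic_seq k T != 0) -> lin_free T.
Proof.
move=> gT C c C0; apply: (@generic_seqP T (inl (C, c)) gT) => /=.
have [c0|c0] := eqVneq c 0; last first.
  exists 0; rewrite /lin_form big1 ?add0r ?fmorph_eq0// => i _.
  by apply: big1 => j _; rewrite mxE mulr0.
have [i [j Cij]] : exists i j, C i j != 0.
  apply: contrapT => h; case/eqP: C0; apply/matrixP => i j; rewrite mxE.
  by apply/eqP; apply: contrapT => /negP Cij; apply: h; exists i, j.
exists (delta_mx i j); rewrite /lin_form c0 rmorph0 addr0.
rewrite (bigD1 i)//= [X in _ + X]big1 ?addr0 => [|i' /negbTE i'i]; last first.
  by apply: big1 => j' _; rewrite mxE i'i mulr0.
rewrite (bigD1 j)//= [X in _ + X]big1 ?addr0 => [|j' /negbTE j'j]; last first.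
  by rewrite mxE j'j andbF mulr0.
by rewrite mxE !eqxx mulr1 fmorph_eq0.
Qed.

(** The lattice basis consists of [n] independent integer vectors of [U], hence spans [U]; its
    matrix is one of the indices, and the nonzero determinant leaves only 0 in the intersection. *)
Lemma generic_completely_irrational T : (forall k, generic_seq k T != 0) ->
  completely_irrational T.
Proof.
move=> gT U + dimU; rewrite /rational_subspace dimU => -[b bfree bE].
apply/seteqP; split=> [z [Tz Uz]|_ ->]; last first.
  split; rewrite /graph_subspace /= ?mem0v//.
  suff -> : usubmx (0 : 'cV[R]_(m + n)) = 0.
    by rewrite mulmx0; apply/matrixP => i j; rewrite !mxE.
  by apply/matrixP => i j; rewrite !mxE.
have bi (i : 'I_n) : (b`_i \in U) /\ exists a, intv R a = b`_i.
  have : ([set v | inIntSpan b v] : set _) b`_i.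
    exists [ffun j => (j == i)%:R]; rewrite (bigD1 i)//= big1 ?addr0.
      by rewrite ffunE eqxx mulr1z.
    by move=> j /negbTE ji; rewrite ffunE ji mulr0z.
  by rewrite -bE => -[bU [a _ aE]]; split => //; exists a.
have /choice[a aE] : forall i : 'I_n, exists a, intv R a = b`_i.
  by move=> i; have [] := bi i.
pose B : 'M[int]_(m + n, n) := \matrix_(j, i) a i j 0.
pose BR : 'M[R]_(m + n, n) := map_mx intr B.
have BRE (c : 'cV[R]_n) : BR *m c = \sum_i c i 0 *: b`_i.
  apply/matrixP => j l; rewrite ord1 mxE summxE; apply: eq_bigr => i _.
  by rewrite -aE !mxE mulrC.
have BRfree (c : 'cV[R]_n) : BR *m c = 0 -> c = 0.
  rewrite BRE => h; apply/matrixP => i j; rewrite ord1 mxE.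
  by move/freeP: bfree => /(_ (fun i => c i 0) h).
have := @generic_seqP T (inr B) gT; rewrite /= -/BR => h.
have {}h : graph_det BR T != 0.
  apply/h/graph_det_neq0; rewrite -kermx_eq0; apply/rowV0P => v.
  by move=> /sub_kermxP/(congr1 trmx); rewrite trmx_mul trmxK trmx0 => /BRfree
    /(congr1 trmx); rewrite trmxK trmx0.
have spanb : <<b>>%VS = U.
  apply/eqP; rewrite eqEdim; apply/andP; split.
    apply/span_subvP => v /(nthP 0)[i]; rewrite size_tuple => ilt <-.
    by have [] := bi (Ordinal ilt).
  by rewrite dimU; move: bfree; rewrite /free size_tuple => /eqP->.
have zE : z = BR *m (\col_i coord b i z).
  rewrite BRE [LHS](@coord_span _ _ _ b) ?spanb//.
  by apply: eq_bigr => i _; rewrite mxE.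
set c := \col_i _ in zE.
have c0 : (dsubmx BR - T *m usubmx BR) *m c = 0.
  apply/eqP; rewrite mulmxBl -mulmxA subr_eq0; apply/eqP.
  have e : BR *m c = col_mx (usubmx BR *m c) (dsubmx BR *m c).
    by rewrite -mul_col_mx vsubmxK.
  by move: Tz; rewrite /graph_subspace /= zE e col_mxKd col_mxKu.
have : c = 0.
  have u : dsubmx BR - T *m usubmx BR \in unitmx.
    by rewrite unitmxE unitfE.
  by rewrite -[c]mul1mx -(mulVmx u) -mulmxA c0 mulmx0.
by rewrite zE => ->; rewrite mulmx0.
Qed.

End GenericFamily.

(** * One stage of the construction *)

Section NearLine.
Variables (R : realType) (m n : nat).
Implicit Types (T S G : 'M[R]_(n, m)).

Lemma near_line T G (P : set 'M[R]_(n, m)) : (\forall S \near T, P S) ->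
  \forall t \near (0 : R)^'+, P (T + t *: G).
Proof.
move=> /nbhs_normP[e /= e0 eP].
have G1 : 0 < `|G| + 1 by rewrite ltr_wpDl.
have d0 : 0 < e / (`|G| + 1) by rewrite divr_gt0.
near=> t; apply: eP; rewrite /ball_ /= opprD addrA subrr add0r normrN normrZ.
have t0 : 0 < t by near: t; exact: nbhs_right_gt.
have te : t < e / (`|G| + 1) by near: t; exact: nbhs_right_lt.
rewrite ltr_pdivlMr// in te; rewrite gtr0_norm//; apply: le_lt_trans te.
by rewrite ler_pM2l// lerDl.
Unshelve. all: by end_near. Qed.

Lemma dist_int_continuous (x : 'cV[int]_m) :
  continuous (fun T => dist_int (T *m intv R x)).
Proof.
move=> T; apply/(@cvgrPdist_lt _ _ _ (nbhs T)) => e e0.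
pose C := \sum_j `|intv R x j 0| + 1.
have C0 : 0 < C by rewrite ltr_wpDl// sumr_ge0.
have mulC (A : 'M[R]_(n, m)) : `|A *m intv R x| <= `|A| * C.
  apply: mxnorm_le => [|i j]; first by rewrite mulr_ge0// ltW.
  rewrite ord1 mxE; apply: le_trans (ler_norm_sum _ _ _) _.
  rewrite mulrDr mulr1 mulr_sumr.
  apply: le_trans (_ : _ <= \sum_j `|A| * `|intv R x j 0|) _.
    by apply: ler_sum => l _; rewrite normrM ler_wpM2r// ler_mxnorm.
  by rewrite lerDl.
suff : \forall S \near T,
    `|dist_int (T *m intv R x) - dist_int (S *m intv R x)| < e by [].
apply/nbhs_normP; exists (e / C) => /=; first by rewrite divr_gt0.
move=> S; rewrite /ball_ /= ltr_pdivlMr// => TS.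
have h1 := dist_int_lipschitz (T *m intv R x) (S *m intv R x).
have h2 := dist_int_lipschitz (S *m intv R x) (T *m intv R x).
rewrite -mulmxBl in h1; rewrite distrC -mulmxBl in h2.
have := mulC (T - S); rewrite ltr_norml => h3; apply/andP; split; lra.
Qed.

Lemma near_notint (al g : R) : g != 0 ->
  \forall t \near (0 : R)^'+, forall z : int, al + t * g != z%:~R.
Proof.
move=> g0; have /andP[h1 h2] := real_floor_itv (num_real al).
set f := Num.floor al in h1 h2; rewrite intrD in h2.
(* The distance from [al] to the closest integer other than [al] itself. *)
pose d := Num.min 1
  (if f%:~R == al then 1 else Num.min (al - f%:~R) (f%:~R + 1 - al)).
have d0 : 0 < d.
  rewrite lt_min ltr01 /=; case: ifP => [//|/negbT fal].
  by rewrite lt_min !subr_gt0 h2 lt_neqAle fal h1.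
near=> t.
have t0 : 0 < t by near: t; exact: nbhs_right_gt.
have td : t < d / `|g|.
  by near: t; apply: nbhs_right_lt; rewrite divr_gt0// normr_gt0.
rewrite ltr_pdivlMr ?normr_gt0// -[t]gtr0_norm// -normrM in td.
have tg0 : t * g != 0 by rewrite mulf_neq0// gt_eqF.
move: (t * g) tg0 td => w w0; rewrite /d lt_min ltr_norml => /andP[/andP[w1 w2]].
move=> + z; apply: contraTneq => zE; rewrite -leNgt.
have zf : z%:~R - f%:~R = al + w - f%:~R :> R by rewrite zE.
case: ifP => [/eqP fal|fal].
  exfalso; move: w0; rewrite -fal addrAC subrr add0r -rmorphB /= in zf.
  have {}w1 : -1 < (z - f)%:~R :> R by rewrite zf.
  have {}w2 : (z - f)%:~R < 1 :> R by rewrite zf.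
  rewrite -(rmorphN1 (intmul 1)) /= ltr_int in w1; rewrite (ltr_int R _ 1) in w2.
  have -> : w = 0 by rewrite -zf (_ : z - f = 0)//; lia.
  by rewrite eqxx.
rewrite leNgt lt_min !ltr_norml; apply/negP => /andP[/andP[a1 a2] /andP[b1 b2]].
have c1 : f%:~R < z%:~R :> R by rewrite -zE; lra.
have c2 : z%:~R < (f + 1)%:~R :> R by rewrite -zE intrD; lra.
rewrite !ltr_int in c1 c2; lia.
Unshelve. all: by end_near. Qed.

(** Sup-norm balls are products of intervals: in each entry the supremum of the lower ends lies in
    all the intervals. *)
Lemma box_nested (T : nat -> 'M[R]_(n, m)) (r : nat -> R) :
  (forall k, 0 < r k) ->
  (forall k S, `|T k.+1 - S| <= r k.+1 -> `|T k - S| <= r k) ->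
  exists S, forall k, `|T k - S| <= r k.
Proof.
move=> r0 nest.
have nest' k l S : (k <= l)%N -> `|T l - S| <= r l -> `|T k - S| <= r k.
  move/subnK => <-; elim: (l - k)%N => // d IH; rewrite addSn => h.
  exact/IH/nest.
have cross k l i j : T k i j - r k <= T l i j + r l.
  have [M [kM lM]] : exists M, (k <= M)%N /\ (l <= M)%N.
    by exists (maxn k l); rewrite leq_maxl leq_maxr.
  have TM : `|T M - T M| <= r M by rewrite subrr normr0 ltW.
  have := le_trans (ler_mxnorm _ i j) (nest' _ _ _ kM TM).
  have := le_trans (ler_mxnorm _ i j) (nest' _ _ _ lM TM).
  by rewrite !mxE !ler_norml => /andP[? ?] /andP[? ?]; lra.
pose E i j := [set T k i j - r k | k in [set: nat]].
exists (\matrix_(i, j) sup (E i j)) => k; apply: mxnorm_le => [|i j].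
  exact: ltW.
rewrite !mxE.
have lo : T k i j - r k <= sup (E i j).
  apply: ub_le_sup; last by exists k.
  by exists (T 0%N i j + r 0%N) => _ [l _ <-]; exact: cross.
have hi : sup (E i j) <= T k i j + r k.
  apply: ge_sup; first by exists (T 0%N i j - r 0%N), 0%N.
  by move=> _ [l _ <-]; exact: cross.
by rewrite ler_norml; apply/andP; split; lra.
Qed.

End NearLine.

Section Step.
Variables (R : realType) (m n : nat) (n0 : (0 < n)%N).
Implicit Types (T S : 'M[R]_(n, m)) (a b : 'I_m) (x : 'cV[int]_m).

Definition col_rational T a (q : nat) :=
  forall i, exists z : int, q%:R * T i a = z%:~R.

Definition axis a (q : nat) : 'cV[int]_m := q%:Z *: delta_mx a 0.

Definition off_axes a b x := exists2 j, (j != a) && (j != b) & x j 0 != 0.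

Lemma axis_entry T a q i : (T *m intv R (axis a q)) i 0 = q%:R * T i a.
Proof.
rewrite mxE (bigD1 a)//= big1 ?addr0 => [|j /negbTE ja].
  by rewrite !mxE !eqxx mulr1 mulrC.
by rewrite !mxE ja mulr0 mulr0.
Qed.

Lemma dist_axis_rational T a q : col_rational T a q ->
  dist_int (T *m intv R (axis a q)) = 0.
Proof.
move=> /choice[z zE]; rewrite (_ : _ *m _ = intv R (\col_i z i)).
  exact: dist_int_intv.
by apply/matrixP => i j; rewrite ord1 axis_entry zE !mxE.
Qed.

Lemma col_rational_near T b q e : 0 < e -> exists T' q', [/\ (q < q')%N,
  `|T - T'| < e, col_rational T' b q' & forall i j, j != b -> T' i j = T i j].
Proof.
(* Rounding column [b] down to multiples of 1/q' moves each entry by at most 1/q', which is below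
   [e]. *)
move=> e0; pose q' := maxn q.+1 (Num.bound e^-1).
have q'0 : 0 < q'%:R :> R by rewrite ltr0n /q' leq_max.
have q'e : q'%:R^-1 < e.
  rewrite invf_plt ?posrE//; apply: lt_le_trans (archi_boundP _) _.
    by rewrite invr_ge0 ltW.
  by rewrite ler_nat leq_maxr.
exists (\matrix_(i, j) if j == b then (Num.floor (q'%:R * T i j))%:~R / q'%:R
  else T i j), q'; split.
- by rewrite leq_maxl.
- apply: le_lt_trans q'e; apply: mxnorm_le => [|i j]; first by rewrite invr_ge0 ltW.
  rewrite !mxE; case: ifP => _; last by rewrite subrr normr0 invr_ge0 ltW.
  have /andP[h1 h2] := real_floor_itv (num_real (q'%:R * T i j)).
  set f := Num.floor _ in h1 h2 *; rewrite intrD in h2.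
  have -> : T i j - f%:~R / q'%:R = (q'%:R * T i j - f%:~R) / q'%:R.
    by rewrite mulrBl mulrAC divff ?mul1r// gt_eqF.
  rewrite normrM [X in _ * X]gtr0_norm ?invr_gt0//.
  apply: ler_piMl; first by rewrite invr_ge0 ltW.
  by rewrite ler_norml; apply/andP; split; lra.
- move=> i; exists (Num.floor (q'%:R * T i b)); rewrite mxE eqxx.
  by rewrite mulrC divfK// gt_eqF.
- by move=> i j /negbTE jb; rewrite mxE jb.
Qed.

(* The perturbation only changes row 0 outside columns [a] and [b], by a small
   multiple of the powers of a suitable [s]. *)
Lemma off_axes_notint T a b N (P : set 'M[R]_(n, m)) :
  (\forall S \near T, P S) -> exists S, [/\ P S,
    (forall i, S i a = T i a), (forall i, S i b = T i b) &
    forall x, off_axes a b x -> (nrm x <= N)%N -> 0 < dist_int (S *m intv R x)].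
Proof.
move=> PT; pose i0 := Ordinal n0.
(* The value of [p v] at [s] will be the entry in row 0 of the perturbation applied to [boxv v].
   Finitely many nonzero polynomials have a common non-root [s]. *)
pose p (v : {ffun 'I_m -> 'I_(N.*2.+1)}) : {poly R} :=
  \sum_j ((j != a) && (j != b))%:R * (boxv v j 0)%:~R *: 'X^j.
have p0 v : off_axes a b (boxv v) -> p v != 0.
  move=> [j jab xj]; apply: contra_neq xj => pv.
  have : (p v)`_j = 0 by rewrite pv coef0.
  rewrite /p coef_sum (bigD1 j)//= big1 ?addr0 => [|l lj].
    by rewrite coefZ coefXn eqxx jab mul1r mulr1 => /eqP; rewrite intr_eq0 => /eqP.
  by rewrite coefZ coefXn [_ == _ :> nat]eq_sym val_eqE (negbTE lj) mulr0.
have [s sP] : exists s : R, forall v, off_axes a b (boxv v) -> (p v).[s] != 0.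
  apply: (@filter_ex _ (0 : R)^'+ _).
  apply: (@filter_forall _ _ _ (0 : R)^'+) => v.
  have [/p0/near_poly_neq0|nv] := pselect (off_axes a b (boxv v)).
    by apply: filterS.
  by near=> t.
pose G : 'M[R]_(n, m) :=
  \matrix_(i, j) if (i == i0) && ((j != a) && (j != b)) then s ^+ j else 0.
have Gx v : (G *m intv R (boxv v)) i0 0 = (p v).[s].
  rewrite mxE /p horner_sum; apply: eq_bigr => j _.
  rewrite !mxE eqxx hornerZ hornerXn /=; case: ifP => _; last by rewrite !mul0r.
  by rewrite mul1r mulrC.
pose Q (v : {ffun 'I_m -> 'I_(N.*2.+1)}) : set R := [set t |
  off_axes a b (boxv v) -> 0 < dist_int ((T + t *: G) *m intv R (boxv v))].
have near_v : \forall t \near (0 : R)^'+, forall v, Q v t.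
  apply: filter_forall => v.
  have [/sP pv|nv] := pselect (off_axes a b (boxv v)); last by near=> t.
  apply: filterS (near_notint ((T *m intv R (boxv v)) i0 0) pv) => t nt _.
  apply: (@dist_int_gt0 _ _ _ i0) => z.
  by rewrite mulmxDl -scalemxAl mxE [X in _ + X]mxE Gx.
have [t [tP Pt]] :=
  @filter_ex _ (0 : R)^'+ _ _ (filterI near_v (near_line G PT)).
exists (T + t *: G); split => //.
- by move=> i; rewrite !mxE eqxx andbF mulr0 addr0.
- by move=> i; rewrite !mxE eqxx !andbF mulr0 addr0.
- by move=> x off /boxv_surj[v xE]; rewrite xE in off *; exact: tP.
Unshelve. all: by end_near. Qed.

Lemma polyfun_near_neq0 f T : polyfun f -> f T != 0 ->
  \forall S \near T, f S != 0.
Proof.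
move=> /polyfun_continuous/(_ T) fc fT.
exact: (@cvgr_neq0 R R _ (nbhs T) _ f (f T) fc fT).
Qed.

Lemma dist_int_near_lt T x c : dist_int (T *m intv R x) < c ->
  \forall S \near T, dist_int (S *m intv R x) < c.
Proof.
exact: (@cvgr_lt R _ (nbhs T) _ (fun S => dist_int (S *m intv R x)) _
  (@dist_int_continuous R m n x T) c).
Qed.

Lemma dist_int_near_gt T x c : c < dist_int (T *m intv R x) ->
  \forall S \near T, c < dist_int (S *m intv R x).
Proof.
exact: (@cvgr_gt R _ (nbhs T) _ (fun S => dist_int (S *m intv R x)) _
  (@dist_int_continuous R m n x T) c).
Qed.

Lemma construction_step f T r q a b (k : nat) : polyfun f -> (exists S, f S != 0) ->
  a != b -> 0 < r -> col_rational T a q ->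
  exists T' r' q', [/\ 0 < r', (q < q')%N, col_rational T' b q',
    forall S, `|T' - S| <= r' -> `|T - S| <= r
  & forall S, `|T' - S| <= r' -> [/\ f S != 0,
      forall x, off_axes a b x -> (nrm x < q')%N ->
        dist_int (S *m intv R (axis a q)) < dist_int (S *m intv R x)
    & q'%:R * dist_int (S *m intv R (axis a q)) < k.+1%:R^-1]].
Proof.
move=> fpoly [G fG] ab r0 Ta.
have near_ball (A B : 'M[R]_(n, m)) (e : R) : `|A - B| < e ->
    \forall S \near B, `|A - S| < e.
  move=> ABe; apply/nbhs_normP; exists (e - `|A - B|); rewrite /= ?subr_gt0//.
  move=> S /=; rewrite ltrBrDl; apply: le_lt_trans.
  by rewrite -[A - S](subrKA B); exact: ler_normD.
(* [T1] leaves the zero set of [f]; [T2] then makes column [b] rational, keeping [f] nonzero. *)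
have [T1 [fT1 TT1]] : exists T1, f T1 != 0 /\ `|T - T1| < r.
  have near_f : \forall t \near (0 : R)^'+, f (T + t *: (G - T)) != 0.
    by apply: polyfun_near_line => //; rewrite addrC subrK.
  have TT : `|T - T| < r by rewrite subrr normr0.
  have [t [? ?]] := @filter_ex _ (0 : R)^'+ _ _
    (filterI near_f (near_line (G - T) (near_ball _ _ _ TT))).
  by exists (T + t *: (G - T)).
have /nbhs_normP[e /= e0 eP] : \forall S \near T1, f S != 0 /\ `|T - S| < r.
  apply: filterI; last exact: near_ball.
  exact: polyfun_near_neq0.
have [T2 [q' [qq' T12 T2b _]]] := col_rational_near T1 b q e0.
have [fT2 TT2] := eP _ T12.
(* The moves so far may have spoilt column [a]; its rational value is restored, possibly at the cost
   of [f] vanishing again. [T4] treats the remaining columns. *)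
pose T3 : 'M[R]_(n, m) := \matrix_(i, j) if j == a then T i j else T2 i j.
have TT3 : `|T - T3| < r.
  apply: le_lt_trans TT2; apply: mxnorm_le => // i j; rewrite !mxE.
  case: ifP => _; first by rewrite subrr normr0.
  by have := ler_mxnorm (T - T2) i j; rewrite !mxE.
have [T4 [TT4 T4a T4b T4off]] := off_axes_notint a b q' (near_ball _ _ _ TT3).
have T4a0 : dist_int (T4 *m intv R (axis a q)) = 0.
  apply: dist_axis_rational => i; have [z zE] := Ta i; exists z.
  by rewrite T4a mxE eqxx.
have T4bE i : T4 i b = T2 i b by rewrite T4b mxE eq_sym (negbTE ab).
pose good_at S := [/\ `|T - S| < r,
      forall x, off_axes a b x -> (nrm x < q')%N ->
        dist_int (S *m intv R (axis a q)) < dist_int (S *m intv R x)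
    & q'%:R * dist_int (S *m intv R (axis a q)) < k.+1%:R^-1].
(* At [T4] the axis vector has distance 0 and the finitely many off-axis vectors in the box have
   positive distance, so the strict inequalities persist nearby. *)
have near4 : \forall S \near T4, good_at S.
  pose Q (v : {ffun 'I_m -> 'I_(q'.*2.+1)}) : set 'M[R]_(n, m) := [set S |
    off_axes a b (boxv v) -> (nrm (boxv v) <= q')%N ->
    dist_int (S *m intv R (axis a q)) < dist_int (S *m intv R (boxv v))].
  have h1 : \forall S \near T4, forall v, Q v S.
    apply: (@filter_forall _ _ Q (nbhs T4) _) => v.
    have [vP|vP] := pselect (off_axes a b (boxv v) /\ (nrm (boxv v) <= q')%N).
      have vpos := T4off _ vP.1 vP.2.
      set d := dist_int _ in vpos.
      have h1 : \forall S \near T4, d / 2 < dist_int (S *m intv R (boxv v)).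
        by apply: dist_int_near_gt; rewrite -/d; lra.
      have h2 : \forall S \near T4, dist_int (S *m intv R (axis a q)) < d / 2.
        by apply: dist_int_near_lt; rewrite T4a0 divr_gt0.
      by near=> S => _ _; apply: (@lt_trans _ _ (d / 2)); near: S.
    by near=> S => ? ?; exfalso; exact: vP.
  have h2 : \forall S \near T4,
      q'%:R * dist_int (S *m intv R (axis a q)) < k.+1%:R^-1.
    have q'0 : 0 < q'%:R :> R by rewrite ltr0n (leq_ltn_trans _ qq').
    have : \forall S \near T4,
        dist_int (S *m intv R (axis a q)) < k.+1%:R^-1 / q'%:R.
      by apply: dist_int_near_lt; rewrite T4a0 divr_gt0// invr_gt0.
    by apply: filterS => S; rewrite ltr_pdivlMr// mulrC.
  have h3 := near_ball _ _ _ TT4.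
  near=> S; split.
  - by near: S.
  - move=> x off xq; have [v xE] := boxv_surj (ltnW xq).
    rewrite xE in off xq *; move: (v) off (ltnW xq).
    by near: S.
  - by near: S.
(* [f] is nonzero at [T2], hence just after [T4] on the line towards [T2]; these two matrices share
   column [b], which therefore stays rational. *)
have near_f : \forall t \near (0 : R)^'+, f (T4 + t *: (T2 - T4)) != 0.
  by apply: polyfun_near_line => //; rewrite addrC subrK.
have [t [ft /nbhs_normP[e1 /= e10 e1P]]] :=
  @filter_ex _ (0 : R)^'+ _ _
    (filterI near_f (near_line (T2 - T4) (nbhs_interior near4))).
set T5 := T4 + _ in ft e1P.
have /nbhs_normP[e2 /= e20 e2P] : \forall S \near T5, f S != 0.
  exact: polyfun_near_neq0.
exists T5, (Num.min e1 e2 / 2), q'; split => //.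
- by rewrite divr_gt0// lt_min e10 e20.
- move=> i; have [z zE] := T2b i; exists z.
  by rewrite /T5 3!mxE [(- T4) i b]mxE T4bE subrr mulr0 addr0.
- move=> S TS; apply/ltW; suff [] : good_at S by [].
  apply: e1P; rewrite /ball_ /=; apply: le_lt_trans TS _.
  have : 0 < Num.min e1 e2 by rewrite lt_min e10 e20.
  have : Num.min e1 e2 <= e1 by rewrite ge_min lexx.
  lra.
- move=> S TS.
  have m0 : 0 < Num.min e1 e2 by rewrite lt_min e10 e20.
  have m1 : Num.min e1 e2 <= e1 by rewrite ge_min lexx.
  have m2 : Num.min e1 e2 <= e2 by rewrite ge_min lexx orbT.
  have [? ? ?] : good_at S by apply: e1P; rewrite /ball_ /=; lra.
  by split => //; apply: e2P; rewrite /ball_ /=; lra.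
Unshelve. all: by end_near. Qed.

End Step.

(** * The limit matrix *)

Section Construction.
Variables (R : realType) (m n : nat) (n0 : (0 < n)%N).

Definition axis_index k : 'I_m.+2 := if odd k then 1 else 0.

Lemma axis_index_neq k : axis_index k != axis_index k.+1.
Proof. by rewrite /axis_index /=; case: odd. Qed.

Lemma off_axes_supp2 k (x : 'cV[int]_m.+2) : ~ supp2 x ->
  off_axes (axis_index k) (axis_index k.+1) x.
Proof.
move=> nsx; apply: contrapT => h; apply: nsx => j j1; apply/eqP.
apply: contrapT => /negP xj; apply: h; exists j => //.
have j0 : j != 0 by apply: contraTneq j1 => ->.
have j1' : j != 1 by apply: contraTneq j1 => ->.
by rewrite /axis_index /=; case: odd; rewrite /= ?j0 j1'.
Qed.

Lemma nrm_axis k q : nrm (axis (axis_index k) q) = q.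
Proof.
have E i : absz (axis (axis_index k) q i ord0) = (q * (i == axis_index k))%N.
  by rewrite !mxE; case: (i == _); rewrite /= ?mulr1 ?mulr0 ?muln1 ?muln0.
apply/eqP; rewrite eqn_leq; apply/andP; split.
  by apply/bigmax_leqP => i _; rewrite E; case: (i == _); rewrite ?muln1 ?muln0.
by have := nrm_ge (axis (axis_index k) q) (axis_index k); rewrite E eqxx muln1.
Qed.

Lemma singular_matrix_exists : exists (T : 'M[R]_(n, m.+2)) (q : nat -> nat),
  [/\ forall k, generic_seq k T != 0, (0 < q 0)%N, forall k, (q k < q k.+1)%N,
    forall k x, ~ supp2 x -> (nrm x < q k.+1)%N ->
      dist_int (T *m intv R (axis (axis_index k) (q k)))
        < dist_int (T *m intv R x)
  & forall k, (q k.+1)%:R * dist_int (T *m intv R (axis (axis_index k) (q k)))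
      < k.+1%:R^-1].
Proof.
pose state := ('M[R]_(n, m.+2) * R * nat)%type.
pose inv k (s : state) :=
  [/\ 0 < s.1.2, (0 < s.2)%N & col_rational s.1.1 (axis_index k) s.2].
pose rel k (s s' : state) := [/\ (s.2 < s'.2)%N,
  forall S, `|s'.1.1 - S| <= s'.1.2 -> `|s.1.1 - S| <= s.1.2
  & forall S, `|s'.1.1 - S| <= s'.1.2 -> [/\ generic_seq k S != 0,
      forall x, off_axes (axis_index k) (axis_index k.+1) x -> (nrm x < s'.2)%N ->
        dist_int (S *m intv R (axis (axis_index k) s.2)) < dist_int (S *m intv R x)
    & s'.2%:R * dist_int (S *m intv R (axis (axis_index k) s.2)) < k.+1%:R^-1]].
(* A state consists of centre, radius and denominator. The choice function must be total, so a state
   violating the invariant is returned unchanged. *)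
have /choice[nx nxP] : forall ks : nat * state, exists s',
    inv ks.1 ks.2 -> inv ks.1.+1 s' /\ rel ks.1 ks.2 s'.
  move=> [k s]; have [[r0 q0 sT]|ns] := pselect (inv k s); last by exists s.
  have [T' [r' [q' [? qq' ? ? ?]]]] := construction_step n0 k
    (polyfun_generic_seq R m.+2 n k) (generic_seq_neq0 R m.+2 n k)
    (axis_index_neq k) r0 sT.
  by exists (T', r', q') => _; do 2 split => //=; exact: leq_ltn_trans qq'.
pose s := fix s k := if k is k'.+1 then nx (k', s k') else (0, 1, 1%N) : state.
have sinv k : inv k (s k).
  elim: k => [|k IH]; last by have [] := nxP (k, s k) IH.
  by split => //= i; exists 0; rewrite mxE mulr0.
have srel k : rel k (s k) (s k.+1) by have [] := nxP (k, s k) (sinv k).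
have [||T TP] := @box_nested R m.+2 n (fun k => (s k).1.1) (fun k => (s k).1.2).
- by move=> k; have [] := sinv k.
- by move=> k S; have [_ + _] := srel k; apply.
exists T, (fun k => (s k).2); split.
- by move=> k; have [_ _ /(_ T (TP k.+1))[]] := srel k.
- by have [] := sinv 0%N.
- by move=> k; have [] := srel k.
- move=> k x nsx xq; have [_ _ /(_ T (TP k.+1))[_ + _]] := srel k.
  by apply => //; exact: off_axes_supp2.
- by move=> k; have [_ _ /(_ T (TP k.+1))[]] := srel k.
Qed.

End Construction.

(** * Best approximations of the limit matrix *)

Section Conclusion.
Variables (R : realType) (m n : nat) (n0 : (0 < n)%N).
Variables (T : 'M[R]_(n, m.+2)) (q : nat -> nat).
Let D (x : 'cV[int]_m.+2) := dist_int (T *m intv R x).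
Let ax k := axis (@axis_index m k) (q k).

Hypotheses (Tfree : lin_free T) (q0 : (0 < q 0)%N).
Hypothesis qlt : forall k, (q k < q k.+1)%N.
Hypothesis off_far : forall k x, ~ supp2 x -> (nrm x < q k.+1)%N -> D (ax k) < D x.
Hypothesis ax_close : forall k, (q k.+1)%:R * D (ax k) < k.+1%:R^-1.

Let qpos k : (0 < q k)%N.
Proof. by case: k => // k; exact: leq_ltn_trans (qlt k). Qed.

Let ax0 k : ax k != 0.
Proof. by rewrite -nrm_eq0 nrm_axis -lt0n qpos. Qed.

Let inv_lt e : 0 < e -> exists k, k.+1%:R^-1 < e :> R.
Proof.
move=> e0; exists (Num.bound e^-1); rewrite invf_plt ?posrE ?ltr0n//.
apply: lt_trans (archi_boundP _) _; first by rewrite invr_ge0 ltW.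
by rewrite ltr_nat.
Qed.

Lemma dist_arbitrarily_small e : 0 < e -> exists2 w, w != 0 & D w < e.
Proof.
move=> /inv_lt[k ke]; exists (ax k) => //; apply: le_lt_trans ke.
apply: le_trans (ltW (ax_close k)).
by rewrite ler_peMl ?dist_int_ge0// ler1n.
Qed.

Variable z : nat -> 'cV[int]_(m.+2 + n).
Hypothesis bz : best_approx_seq T z.

(** A best approximation with height in [q_k, q_(k+1)) is at least as good as the axis vector of
    height q_k, whereas every vector outside the plane is worse. *)
Lemma best_approx_supp2 :
  exists nu0, forall nu, (nu0 <= nu)%N -> supp2 (usubmx (z nu)).
Proof.
exists (q 0) => nu qnu; have [/(_ nu)[xb _] _ _ _] := bz.
have : (q 0 <= nrm (usubmx (z nu)))%N.
  by apply: leq_trans qnu (increasing_ge (best_approx_seq_lt bz) nu).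
move=> /(increasing_locate qlt)[k /andP[h1 h2]].
apply: contrapT => /(off_far)/(_ h2); apply/negP; rewrite -leNgt.
by apply: best_approx_min xb (ax0 k) _; rewrite nrm_axis.
Qed.

Lemma best_approx_singular e : 0 < e -> exists nu0, forall nu, (nu0 <= nu)%N ->
  D (usubmx (z nu)) * (nrm (usubmx (z nu.+1)))%:R < e.
Proof.
move=> /inv_lt[K Ke]; exists (q K) => nu qnu.
(* Locating the predecessor gives q_k < |x_(nu+1)| <= q_(k+1): the axis vector is strictly shorter
   than x_(nu+1), so x_nu is at least as good as it, and the product is at most
   [(q k.+1)%:R * D (ax k)]. *)
have /(increasing_locate qlt) : (q 0 <= (nrm (usubmx (z nu.+1))).-1)%N.
  have := increasing_ge (best_approx_seq_lt bz) nu.+1.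
  have : (q 0 <= q K)%N.
    by case: K {Ke} qnu => // K _; exact/ltnW/increasing_lt.
  lia.
have znu := increasing_ge (best_approx_seq_lt bz) nu.+1.
move=> [k /andP[h1 h2]].
have Kk : (K <= k)%N.
  rewrite leqNgt; apply/negP => kK.
  have : (q k.+1 <= q K)%N.
    by move: kK; rewrite leq_eqVlt => /orP[/eqP->//|/(increasing_lt qlt)/ltnW].
  lia.
apply: lt_trans Ke; apply: lt_le_trans (_ : k.+1%:R^-1 <= _); last first.
  by rewrite lef_pV2 ?posrE ?ltr0n// ler_nat.
apply: le_lt_trans (ax_close k); rewrite mulrC ler_pM ?dist_int_ge0//.
  by rewrite ler_nat; lia.
by apply: best_approx_seq_min => //; rewrite nrm_axis; lia.
Qed.

End Conclusion.

Theorem theorem1 (R : realType) (m n : nat) :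
  (2 <= n)%N -> (2 <= m)%N -> (n <= m)%N ->
  exists Theta : 'M[R]_(n, m),
    completely_irrational Theta /\ good Theta /\
    best_approx_dim Theta (n + 2)%N.
Proof.
case: m => [|[|m]] // n2 _ _; have n0 : (0 < n)%N by apply: ltnW.
have [T [q [gen q0 qlt off_far ax_close]]] := @singular_matrix_exists R m n n0.
have Tfree := generic_lin_free gen.
exists T; split; first exact: generic_completely_irrational gen.
split.
  exact: good_of_lin_free n0 (ltn0Sn _) Tfree
    (dist_arbitrarily_small q0 qlt ax_close).
move=> z bz.
have zsupp := best_approx_supp2 q0 qlt off_far bz.
have zsmall := best_approx_singular n0 Tfree q0 qlt ax_close bz.
split; first exact: eventually_in_dim_supp2 zsupp.
by move=> s; exact: best_approx_dim_ge zsupp zsmall s.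
Qed.
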